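(* Let $\mathbb{F}$ be an arbitrary field, let $E$ be the natural $2$-dimensional representation of $\mathrm{GL}_2(\mathbb{F})$, and let $N\ge 1$ and $d\ge 0$ be integers. Let $\det$ denote the $1$-dimensional determinant representation of $\mathrm{GL}_2(\mathbb{F})$. The map $\phi$ defined in the context is an isomorphism of $\mathrm{GL}_2(\mathbb{F})$-representations \[\mathrm{Sym}^{N-1}E\otimes\bigwedge^{N+1}\mathrm{Sym}^{d+1}E\ \cong\ {\det}^N\otimes\Delta^{(2,1^{N-1})}\mathrm{Sym}^dE,\] where the underlying vector space of ${\det}^N\otimes\Delta^{(2,1^{N-1})}\mathrm{Sym}^dE$ is identified with $\Delta^{(2,1^{N-1})}\mathrm{Sym}^dE$.
   Context: Fix the basis $X,Y$ of $E$. For $c\ge 0$, $\mathrm{Sym}^cE$ is the space of homogeneous polynomials of degree $c$ in $X,Y$ (the quotient version of the symmetric power), with basis $X^{c-i}Y^i$, $0\le i\le c$, with the induced action of $\mathrm{GL}_2(\mathbb{F})$. Exterior powers and tensor products carry the induced actions. For a vector space $V$, $\Delta^{(2,1^{N-1})}V$ is the kernel of the multiplication map $\mu_N:\bigwedge^N V\otimes V\to\bigwedge^{N+1}V$, $v_1\wedge\cdots\wedge v_N\otimes w\mapsto v_1\wedge\cdots\wedge v_N\wedge w$. For $c,r\ge 0$ let $I^{(c)}(r)=\{0,1,\ldots,c\}^r$. For $\mathbf{i}\in I^{(c)}(r)$ put $|\mathbf{i}|=\sum_{\alpha}i_\alpha$ and $F^{(c)}_\wedge(\mathbf{i})=X^{c-i_1}Y^{i_1}\wedge\cdots\wedge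 X^{c-i_r}Y^{i_r}\in\bigwedge^r\mathrm{Sym}^cE$; those with $\mathbf{i}$ strictly increasing form a basis. For $\mathbf{i}\in I^{(d)}(N)$ and $j\in\{0,\ldots,d\}$ put $F(\mathbf{i},j)=F^{(d)}_\wedge(\mathbf{i})\otimes X^{d-j}Y^j\in\bigwedge^N\mathrm{Sym}^dE\otimes\mathrm{Sym}^dE$. Write $[a,b)=\{a,a+1,\ldots,b-1\}$. For strictly increasing $\mathbf{k}\in I^{(d+1)}(N+1)$ let $\mathcal{B}(\mathbf{k})=[k_1,k_2)\times[k_2,k_3)\times\cdots\times[k_N,k_{N+1})\subseteq I^{(d)}(N)$. The linear map $\phi:\mathrm{Sym}^{N-1}E\otimes\bigwedge^{N+1}\mathrm{Sym}^{d+1}E\to\bigwedge^N\mathrm{Sym}^dE\otimes\mathrm{Sym}^dE$ is defined on the basis elements, for $s\in\{0,1,\ldots,N-1\}$ and $\mathbf{k}\in I^{(d+1)}(N+1)$ strictly increasing, by \[\phi\bigl(X^{N-1-s}Y^s\otimes F^{(d+1)}_\wedge(\mathbf{k})\bigr)=\sum_{\mathbf{i}\in\mathcal{B}(\mathbf{k})}F\bigl(\mathbf{i},\,s+|\mathbf{k}|-N-|\mathbf{i}|\bigr),\] where the second argument always lies in $\{0,\ldots,d\}$. *)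

(* Defs.v *)
From HB Require Import structures.
From mathcomp Require Import all_boot all_order all_fingroup all_algebra.
From mathcomp Require Import mpoly.

Set Implicit Arguments.
Unset Strict Implicit.
Unset Printing Implicit Defensive.

Import GRing.Theory VectorInternalTheory.
Local Open Scope ring_scope.

Section StrictlyIncreasing.

Definition increasing (r n : nat) (f : {ffun 'I_r -> 'I_n}) : bool :=
  [forall a : 'I_r, forall b : 'I_r, (a < b)%N ==> (f a < f b)%N].

Record incr (r n : nat) := Incr {
  incr_fun :> {ffun 'I_r -> 'I_n};
  incr_funP : increasing incr_fun }.

HB.instance Definition _ r n := [isSub for @incr_fun r n].
HB.instance Definition _ r n := [Finite of incr r n by <:].

Lemma incr_lt r n (S : incr r n) (a b : 'I_r) : (a < b)%N -> (S a < S b)%N.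
Proof. by move=> ab; have /forallP/(_ a)/forallP/(_ b)/implyP := incr_funP S; apply. Qed.

Lemma incr_inj r n (S : incr r n) : injective S.
Proof.
move=> a b e; apply/val_inj => /=.
by case: (ltngtP a b) => // /(incr_lt S); rewrite e ltnn.
Qed.

Lemma incr_sort r n (t : {ffun 'I_r -> 'I_n}) :
  injective t -> exists (S : incr r n) (s : 'S_r), forall a, t a = S (s a).
Proof.
move=> t_inj; pose le := relpre (val : 'I_n -> nat) leq.
pose l := sort_tuple le [tuple t a | a < r].
have /tuple_permP[p lE] : perm_eq l [tuple t a | a < r] by rewrite /= perm_sort.
have lt_ b : tnth l b = t (p b).
  by rewrite (tnth_nth (t b)) lE -tnth_nth !tnth_mktuple.
have lS : sorted le l by apply: sort_sorted => i j; apply: leq_total.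
have Sinc : increasing [ffun b => tnth l b].
  apply/forallP => a; apply/forallP => b; apply/implyP => ab; rewrite !ffunE.
  rewrite ltn_neqAle; apply/andP; split.
    apply/negP => /eqP/val_inj; rewrite !lt_ => /t_inj /perm_inj ba.
    by rewrite ba ltnn in ab.
  rewrite !(tnth_nth (t a)); apply: (sorted_leq_nth (leT := le)) => //.
  1: by move=> x y z; apply: leq_trans.
  all: try exact: ltnW.
  1,2: have -> : size l = r by apply: size_tuple.
  1,2: exact: ltn_ord.
by exists (Incr Sinc), p^-1%g => a; rewrite /= ffunE lt_ permKV.
Qed.

Lemma incr_im_inj r n (S T : incr r n) :
  (forall a, exists b, S a = T b) -> S = T.
Proof.
move=> ST; apply/val_inj/ffunP => /=.
have ST' a : exists b, S a == T b by have [b ->] := ST a; exists b.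
pose h (a : 'I_r) : 'I_r := xchoose (ST' a).
have hE a : S a = T (h a) by apply/eqP/(xchooseP (ST' a)).
have hlt (a b : 'I_r) : (a < b)%N -> (h a < h b)%N.
  move=> ab; have := incr_lt S ab; rewrite !hE; case: (ltngtP (h a) (h b)) => //.
    by move=> /(incr_lt T); case: ltngtP.
  by move=> /val_inj ->; rewrite ltnn.
suff hid : forall a, h a = a by move=> a; rewrite hE hid.
have hge (k : nat) : forall a : 'I_r, a = k :> nat -> (k <= h a)%N.
  elim: k => // k IH a ak.
  have kr : (k < r)%N by have := ltn_ord a; rewrite ak => /ltnW.
  apply: leq_ltn_trans (IH (Ordinal kr) erefl) _.
  by apply: hlt; rewrite /= ak.
have hle (k : nat) : forall a : 'I_r, (a + k.+1 = r)%N -> (h a <= a)%N.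
  elim: k => [|k IH] a ak; first by rewrite -ltnS (leq_trans (ltn_ord (h a))) // -addn1 (eq_leq (esym ak)).
  have kr : (a.+1 < r)%N by apply: leq_trans (eq_leq ak); rewrite !addnS !ltnS leq_addr.
  have := IH (Ordinal kr); rewrite /= addSnnS => /(_ ak) hk; rewrite -ltnS.
  by apply: leq_trans hk; apply: hlt => /=.
move=> a; apply/val_inj/eqP; rewrite eqn_leq /= hge // andbT.
apply: (hle (r - a.+1)%N); by rewrite addnS -addSn subnKC.
Qed.

End StrictlyIncreasing.

Section Alternating.

Variables (F : fieldType) (V W : vectType F) (r : nat).
Implicit Types (f g : {ffun 'I_r -> V} -> W) (v : {ffun 'I_r -> V}).

Definition upd v (a : 'I_r) (x : V) : {ffun 'I_r -> V} :=
  [ffun b => if b == a then x else v b].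

Definition multilinear f := forall v a, linear (fun x => f (upd v a x)).

Definition alternating f :=
  multilinear f /\ forall v a b, a != b -> v a = v b -> f v = 0.

Lemma upd_id v a : upd v a (v a) = v.
Proof. by apply/ffunP => b; rewrite ffunE; case: eqP => // ->. Qed.

Lemma multilinear_sum f v a n (c : 'I_n -> F) (e : 'I_n -> V) :
  multilinear f ->
  f (upd v a (\sum_j c j *: e j)) = \sum_j c j *: f (upd v a (e j)).
Proof.
move=> fm; pose h := HB.pack_for {linear V -> W} (fun x => f (upd v a x))
  (GRing.isLinear.Build _ _ _ _ _ (fm v a)).
rewrite -[LHS]/(h _) linear_sum; apply: eq_bigr => j _; by rewrite linearZ.
Qed.

Lemma alternating_sub f g :
  alternating f -> alternating g -> alternating (fun v => f v - g v).
Proof.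
move=> [fm fa] [gm ga]; split=> [v a c x y|v a b ab vab].
  by rewrite fm gm scalerBr opprD addrACA.
by rewrite (fa _ a b) // (ga _ a b) // subrr.
Qed.

Lemma alternating_swap f v a b : alternating f -> a != b ->
  f [ffun i => v (tperm a b i)] = - f v.
Proof.
move=> [fm fa] ab; pose w x y := upd (upd v a x) b y.
have wl y : linear (fun x => f (w x y)).
  move=> c x x'; have E z : w z y = upd (upd v b y) a z.
    apply/ffunP=> i; rewrite !ffunE; case: eqP => [->|//].
    by rewrite eq_sym (negPf ab).
  by rewrite !E; apply: fm.
have wr x : linear (fun y => f (w x y)) by apply: fm.
have wd x : f (w x x) = 0.
  by apply: (fa _ a b) => //; rewrite !ffunE eqxx (negPf ab) eqxx.
have addl x x' y : f (w (x + x') y) = f (w x y) + f (w x' y).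
  by have := wl y 1 x x'; rewrite !scale1r.
have addr x y y' : f (w x (y + y')) = f (w x y) + f (w x y').
  by have := wr x 1 y y'; rewrite !scale1r.
have := wd (v a + v b); rewrite addl !addr !wd add0r addr0 => /eqP.
rewrite addrC addr_eq0 => /eqP E.
have -> : [ffun i => v (tperm a b i)] = w (v b) (v a).
  apply/ffunP => i; rewrite !ffunE; case: tpermP => [->|->|].
  - by rewrite (negPf ab) eqxx.
  - by rewrite eqxx.
  - by move=> /eqP/negPf-> /eqP/negPf->.
rewrite E; congr (- f _); rewrite /w.
by apply/ffunP => i; rewrite !ffunE; case: eqP => [->//|]; case: eqP => [->|].
Qed.

Lemma alternating_eq n (e : 'I_n -> V) f g :
  (forall x, exists c : 'I_n -> F, x = \sum_j c j *: e j) ->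
  alternating f -> alternating g ->
  (forall S : incr r n, f [ffun a => e (S a)] = g [ffun a => e (S a)]) ->
  f =1 g.
Proof.
move=> espan fA gA fg; pose h v := f v - g v.
have hA : alternating h by apply: alternating_sub.
suff h0 v : h v = 0 by move=> v; apply/eqP; rewrite -subr_eq0 -/(h v) h0.
have perm0 (s : 'S_r) u : h u = 0 -> h [ffun i => u (s i)] = 0.
  case: (prod_tpermP s) => ts ->{s} dts; elim: ts dts u => [_|t ts IH /= /andP[dt dts]] u hu.
    rewrite big_nil (_ : finfun _ = u) //.
    by apply/ffunP => i; rewrite ffunE perm1.
  rewrite big_cons; have := IH dts u hu; set w := finfun _ => hw.
  rewrite (_ : finfun _ = [ffun i => w (tperm t.1 t.2 i)]).
    by rewrite alternating_swap // hw oppr0.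
  by apply/ffunP => i; rewrite !ffunE permM.
have base0 (t : {ffun 'I_r -> 'I_n}) : h [ffun a => e (t a)] = 0.
  case: (boolP (injectiveb t)) => [/injectiveP /incr_sort [S [s tS]]|].
    have <- : [ffun i => [ffun a => e (S a)] (s i)] = [ffun a => e (t a)].
      by apply/ffunP => i; rewrite !ffunE tS.
    by apply: perm0; rewrite /h fg subrr.
  case/injectivePn => a [b ab tab]; apply: (hA.2 _ _ _ ab).
  by rewrite !ffunE tab.
have part0 (k : nat) (u : {ffun 'I_r -> V}) :
    (forall a : 'I_r, (k <= a)%N -> exists j, u a = e j) -> h u = 0.
  elim: k u => [|k IH] u hu.
    have uE a : exists j, u a == e j by have [//|j ->] := hu a; exists j.
    rewrite (_ : u = [ffun a => e ([ffun b => xchoose (uE b)] a)]) ?base0 //.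
    by apply/ffunP => a; rewrite !ffunE; apply/eqP/(xchooseP (uE a)).
  case: (ltnP k r) => kr; last first.
    by apply: IH => a ka; have := leq_ltn_trans ka (ltn_ord a); rewrite ltnNge kr.
  pose a := Ordinal kr; rewrite -(upd_id u a).
  have [c ->] := espan (u a); rewrite multilinear_sum; last exact: hA.1.
  apply: big1 => j _; rewrite IH ?scaler0 // => b kb; rewrite ffunE.
  case: eqP => [_|ba]; first by exists j.
  apply: hu; rewrite ltn_neqAle kb andbT; apply/eqP => E; apply: ba.
  exact/val_inj.
by apply: (part0 r) => a; rewrite leqNgt ltn_ord.
Qed.

End Alternating.

Section Bases.

Variable F : fieldType.

Definition vb (V : vectType F) (j : 'I_(dim V)) : V := r2v (delta_mx 0 j).

Lemma vb_sum (V : vectType F) (x : V) : x = \sum_j v2r x 0 j *: vb j.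
Proof.
rewrite -{1}[x]v2rK {1}[v2r x]row_sum_delta linear_sum.
by apply: eq_bigr => j _; rewrite linearZ.
Qed.

Definition is_basis (I : finType) (V : vectType F) (b : I -> V) : bool :=
  basis_of fullv (codom b).

(* The linear map sending b i to w i for all i; meaningful only when b is a
   basis, see linextE *)
Definition linext (I : finType) (V W : vectType F) (b : I -> V) (w : I -> W) :
    'Hom(V, W) :=
  linfun (fun x => \sum_i coord (codom_tuple b) (enum_rank i) x *: w i).

Lemma linextE (I : finType) (V W : vectType F) (b : I -> V) (w : I -> W) i :
  is_basis b -> linext b w (b i) = w i.
Proof.
move=> bB; pose g x := \sum_i coord (codom_tuple b) (enum_rank i) x *: w i.
have gl : linear g.
  move=> c x y; rewrite /g scaler_sumr -big_split; apply: eq_bigr => j _ /=.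
  by rewrite linearP scalerDl scalerA.
pose h := HB.pack_for {linear V -> W} g (GRing.isLinear.Build _ _ _ _ _ gl).
rewrite /linext -[linfun _]/(linfun h) lfunE /= /g.
have bE j : b j = (codom_tuple b)`_(enum_rank j).
  rewrite /= (nth_map j) -?cardE ?ltn_ord //.
  by rewrite nth_enum_rank.
rewrite (bigD1 i) //= {1}bE coord_free ?(basis_free bB) // eqxx scale1r.
rewrite big1 ?addr0 // => j ji; rewrite bE coord_free ?(basis_free bB) //.
by rewrite (inj_eq enum_rank_inj) eq_sym (negPf ji) scale0r.
Qed.

Lemma spanning_basis (I : finType) (V : vectType F) (b : I -> V) :
  (forall x, exists c : I -> F, x = \sum_i c i *: b i) ->
  (#|I| <= dim V)%N -> is_basis b.
Proof.
move=> bs le; rewrite /is_basis basisEdim size_codom dimvf le andbT.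
apply/subvP => x _; have [c ->] := bs x.
by apply: rpred_sum => i _; apply/rpredZ/memv_span/codom_f.
Qed.

Lemma basis_spanning (I : finType) (V : vectType F) (b : I -> V) :
  is_basis b -> forall x, exists c : I -> F, x = \sum_i c i *: b i.
Proof.
move=> bB x; exists (fun i => coord (codom_tuple b) (enum_rank i) x).
rewrite {1}(coord_basis bB (memvf x)) (reindex (@enum_rank I)) /=; last first.
  exact/onW_bij/enum_rank_bij.
apply: eq_bigr => i _; congr (_ *: _).
by rewrite (nth_map i) -?cardE ?ltn_ord // nth_enum_rank.
Qed.

Lemma is_basis_card (I : finType) (V : vectType F) (b : I -> V) :
  is_basis b -> #|I| = dim V.
Proof. by move=> /(@vector.size_basis _ _ _ _ (codom_tuple b)); rewrite dimvf. Qed.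

End Bases.

Section Tensor.

Variable F : fieldType.

(* V (x) W, as matrices of coordinates; the universal property is given by
   tensor_bilinear, tensor_liftE and tensor_hom_eq *)
Definition tensor (V W : vectType F) : vectType F := 'M[F]_(dim V, dim W).

Definition tens (V W : vectType F) (v : V) (w : W) : tensor V W :=
  (v2r v)^T *m v2r w.

Definition is_bilinear (V W U : vectType F) (f : V -> W -> U) :=
  (forall w, linear (f^~ w)) /\ (forall v, linear (f v)).

(* the linear map v (x) w |-> f v w, for a bilinear f *)
Definition tensor_lift (V W U : vectType F) (f : V -> W -> U) :
    'Hom(tensor V W, U) :=
  linfun (fun x : tensor V W =>
    \sum_i \sum_j (x : 'M[F]_(_, _)) i j *: f (vb i) (vb j)).

Lemma tensor_bilinear (V W : vectType F) : is_bilinear (@tens V W).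
Proof.
split=> [w c x y|v c x y]; rewrite /tens.
  by rewrite linearP linearD mulmxDl linearZ -scalemxAl.
by rewrite linearP mulmxDr -scalemxAr.
Qed.

Lemma bilinear_suml (V W U : vectType F) (f : V -> W -> U) (I : finType)
  (c : I -> F) (e : I -> V) w : is_bilinear f ->
  f (\sum_i c i *: e i) w = \sum_i c i *: f (e i) w.
Proof.
move=> [fl _]; pose h := HB.pack_for {linear V -> U} (f^~ w)
  (GRing.isLinear.Build _ _ _ _ _ (fl w)).
by rewrite -[LHS]/(h _) linear_sum; apply: eq_bigr => j _; rewrite linearZ.
Qed.

Lemma bilinear_sumr (V W U : vectType F) (f : V -> W -> U) (I : finType)
  (c : I -> F) (e : I -> W) v : is_bilinear f ->
  f v (\sum_i c i *: e i) = \sum_i c i *: f v (e i).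
Proof.
move=> [_ fr]; pose h := HB.pack_for {linear W -> U} (f v)
  (GRing.isLinear.Build _ _ _ _ _ (fr v)).
by rewrite -[LHS]/(h _) linear_sum; apply: eq_bigr => j _; rewrite linearZ.
Qed.

Lemma tensor_liftE (V W U : vectType F) (f : V -> W -> U) v w :
  is_bilinear f -> tensor_lift f (tens v w) = f v w.
Proof.
move=> fb; pose g (x : tensor V W) :=
  \sum_i \sum_j (x : 'M[F]_(_, _)) i j *: f (vb i) (vb j).
have gl : linear g.
  move=> c x y; rewrite /g scaler_sumr -big_split; apply: eq_bigr => i _ /=.
  rewrite scaler_sumr -big_split; apply: eq_bigr => j _ /=.
  by rewrite !mxE scalerDl scalerA.
pose h := HB.pack_for {linear tensor V W -> U} g
  (GRing.isLinear.Build _ _ _ _ _ gl).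
rewrite /tensor_lift -[linfun _]/(linfun h) lfunE /= /g.
rewrite {2}[v]vb_sum bilinear_suml //; apply: eq_bigr => i _.
rewrite {2}[w]vb_sum bilinear_sumr // scaler_sumr; apply: eq_bigr => j _.
by rewrite scalerA /tens mxE big_ord1 !mxE.
Qed.

Lemma tensor_span (V W : vectType F) (x : tensor V W) :
  x = \sum_i \sum_j (x : 'M[F]_(_, _)) i j *: tens (vb i) (vb j).
Proof.
rewrite {1}[x]matrix_sum_delta; apply: eq_bigr => i _; apply: eq_bigr => j _.
by rewrite /tens /vb !r2vK trmx_delta mul_delta_mx.
Qed.

Lemma tensor_hom_eq (V W U : vectType F) (g h : 'Hom(tensor V W, U)) :
  (forall v w, g (tens v w) = h (tens v w)) -> g = h.
Proof.
move=> gh; apply/lfunP => x; rewrite [x]tensor_span !linear_sum.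
apply: eq_bigr => i _; rewrite !linear_sum; apply: eq_bigr => j _.
by rewrite !linearZ /= gh.
Qed.

Lemma tensor_basis (V W : vectType F) (I J : finType) (b : I -> V) (c : J -> W) :
  is_basis b -> is_basis c ->
  is_basis (fun p : I * J => tens (b p.1) (c p.2)).
Proof.
move=> bB cB; rewrite /is_basis basisEdim size_codom card_prod dimvf.
rewrite (is_basis_card bB) (is_basis_card cB) leqnn andbT.
apply/subvP => x _; rewrite [x]tensor_span.
apply: rpred_sum => i _; apply: rpred_sum => j _; apply: rpredZ.
have tB := tensor_bilinear V W.
have [s ->] := basis_spanning bB (vb i); have [t ->] := basis_spanning cB (vb j).
rewrite bilinear_suml //; apply: rpred_sum => k _; apply: rpredZ.
rewrite bilinear_sumr //; apply: rpred_sum => l _; apply: rpredZ.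
by apply: memv_span; apply/codomP; exists (k, l).
Qed.

Definition tensor_map (V W V' W' : vectType F) (g : 'Hom(V, V')) (h : 'Hom(W, W')) :
    'Hom(tensor V W, tensor V' W') :=
  tensor_lift (fun v w => tens (g v) (h w)).

Lemma tensor_mapE (V W V' W' : vectType F) (g : 'Hom(V, V')) (h : 'Hom(W, W')) v w :
  tensor_map g h (tens v w) = tens (g v) (h w).
Proof.
apply: tensor_liftE; have [tl tr] := tensor_bilinear V' W'.
by split=> [y|x] c x1 x2; rewrite linearP ?tl ?tr.
Qed.

End Tensor.

Section Exterior.

Variable F : fieldType.

(* The r-th exterior power of V: coordinates indexed by the strictly increasing
   r-tuples of basis indices, v_1 /\ ... /\ v_r having the r x r minors of the
   coordinate matrix of v_1, ..., v_r as coordinates; the universal property is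
   given by wedge_alternating, ext_liftE and ext_hom_eq *)
Definition ext (r : nat) (V : vectType F) : vectType F :=
  {ffun incr r (dim V) -> F^o}.

Definition wedge (r : nat) (V : vectType F) (v : {ffun 'I_r -> V}) : ext r V :=
  [ffun S : incr r (dim V) => \det (\matrix_(a, b) v2r (v a) 0 (S b))].

(* the linear map v_1 /\ ... /\ v_r |-> f v, for an alternating f *)
Definition ext_lift (r : nat) (V W : vectType F) (f : {ffun 'I_r -> V} -> W) :
    'Hom(ext r V, W) :=
  linfun (fun x : ext r V =>
    \sum_S (x : {ffun _ -> F^o}) S *: f [ffun a => vb (S a)]).

Lemma wedge_alternating r (V : vectType F) : alternating (@wedge r V).
Proof.
split=> [v a c x y|v a b ab vab]; apply/ffunP => S; rewrite !ffunE; last first.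
  by apply: determinant_alternate ab _ => j; rewrite !mxE vab.
change (\det (\matrix_(a0, b) v2r (upd v a (c *: x + y) a0) 0 (S b)) =
  c * \det (\matrix_(a0, b) v2r (upd v a x a0) 0 (S b)) +
  \det (\matrix_(a0, b) v2r (upd v a y a0) 0 (S b))).
rewrite -[X in _ = _ + X]mul1r.
apply: (determinant_multilinear (i0 := a)).
- by apply/rowP => j; rewrite !mxE !ffunE eqxx linearP !mxE mul1r.
- by apply/matrixP => i j; rewrite !mxE !ffunE eq_sym (negPf (neq_lift _ _)).
- by apply/matrixP => i j; rewrite !mxE !ffunE eq_sym (negPf (neq_lift _ _)).
Qed.

Lemma ext_lift_linear r (V W : vectType F) (f : {ffun 'I_r -> V} -> W) x :
  ext_lift f x = \sum_S (x : {ffun _ -> F^o}) S *: f [ffun a => vb (S a)].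
Proof.
pose g (x : ext r V) := \sum_S (x : {ffun _ -> F^o}) S *: f [ffun a => vb (S a)].
have gl : linear g.
  move=> c y z; rewrite /g scaler_sumr -big_split; apply: eq_bigr => i _ /=.
  by rewrite !ffunE scalerDl scalerA.
pose h := HB.pack_for {linear ext r V -> W} g (GRing.isLinear.Build _ _ _ _ _ gl).
by rewrite /ext_lift -[linfun _]/(linfun h) lfunE.
Qed.

Lemma wedge_vb r (V : vectType F) (S T : incr r (dim V)) :
  (wedge [ffun a => vb (S a)] : {ffun _ -> F^o}) T = (S == T)%:R.
Proof.
rewrite ffunE; have mE a b : (\matrix_(a, b) v2r ([ffun a0 => vb (S a0)] a) 0 (T b)) a b
    = (S a == T b)%:R :> F.
  by rewrite mxE ffunE /vb r2vK mxE eqxx eq_sym.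
case: (S =P T) => [ST|ST].
  rewrite (_ : \matrix_(_, _) _ = 1%:M) ?det1 //; apply/matrixP => a b.
  by rewrite mE ST (inj_eq (@incr_inj _ _ T)) mxE.
case: (boolP [forall a, exists b, S a == T b]) => [/forallP ST'|].
  case: ST; apply: incr_im_inj => a; have /existsP[b /eqP] := ST' a; by exists b.
rewrite negb_forall => /existsP[a]; rewrite negb_exists => /forallP nab.
by rewrite (expand_det_row _ a) big1 // => b _; rewrite mE (negPf (nab b)) mul0r.
Qed.

Lemma vb_span (V : vectType F) (x : V) :
  exists c : 'I_(dim V) -> F, x = \sum_j c j *: vb j.
Proof. by exists (fun j => v2r x 0 j); apply: vb_sum. Qed.

Lemma alternating_comp r (V W U : vectType F) (f : {ffun 'I_r -> V} -> W)
  (h : 'Hom(W, U)) : alternating f -> alternating (fun v => h (f v)).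
Proof.
move=> [fm fa]; split=> [v a c x y|v a b ab vab]; first by rewrite fm linearP.
by rewrite (fa _ a b) // linear0.
Qed.

Lemma ext_liftE r (V W : vectType F) (f : {ffun 'I_r -> V} -> W) v :
  alternating f -> ext_lift f (wedge v) = f v.
Proof.
move=> fA; move: v; apply: (alternating_eq (@vb_span V)) => //.
  exact/alternating_comp/wedge_alternating.
move=> S; rewrite ext_lift_linear (bigD1 S) //= wedge_vb eqxx scale1r.
rewrite big1 ?addr0 // => T TS; rewrite wedge_vb eq_sym (negPf TS); exact: scale0r.
Qed.

Lemma ext_span r (V : vectType F) (x : ext r V) :
  x = \sum_S (x : {ffun _ -> F^o}) S *: wedge [ffun a => vb (S a)].
Proof.
apply/ffunP => T; rewrite sum_ffunE (bigD1 T) //= ffunE wedge_vb eqxx.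
rewrite -[_ *: _]/(_ * _) mulr1 big1 ?addr0 // => S ST.
by rewrite ffunE wedge_vb (negPf ST) scaler0.
Qed.

Lemma ext_hom_eq r (V W : vectType F) (g h : 'Hom(ext r V, W)) :
  (forall v, g (wedge v) = h (wedge v)) -> g = h.
Proof.
move=> gh; apply/lfunP => x; rewrite [x]ext_span !linear_sum.
by apply: eq_bigr => S _; rewrite !linearZ /= gh.
Qed.

Lemma ext_basis r n (V : vectType F) (b : 'I_n -> V) :
  is_basis b -> is_basis (fun S : incr r n => wedge [ffun a => b (S a)]).
Proof.
move=> bB; have nV : n = dim V by rewrite -(is_basis_card bB) card_ord.
rewrite /is_basis basisEdim; apply/andP; split; last first.
  rewrite size_codom dimvf /ext -nV; apply: eq_leq.
  by rewrite -[RHS]/(#|{: incr r n}| * 1)%N muln1.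
set U := <<_>>%VS.
have wU v : wedge v \in U.
  have -> : wedge v = projv U (wedge v).
    move: v; apply: (alternating_eq (basis_spanning bB)).
    - exact: wedge_alternating.
    - exact/alternating_comp/wedge_alternating.
    - move=> S; rewrite projv_id //; apply: memv_span.
      by apply/codomP; exists S.
  exact: memv_proj.
apply/subvP => x _; rewrite [x]ext_span.
by apply: rpred_sum => S _; apply/rpredZ/wU.
Qed.

Definition ext_map (r : nat) (V W : vectType F) (h : 'Hom(V, W)) :
    'Hom(ext r V, ext r W) :=
  ext_lift (fun v => wedge [ffun a => h (v a)]).

Lemma ext_mapE r (V W : vectType F) (h : 'Hom(V, W)) (v : {ffun 'I_r -> V}) :
  ext_map r h (wedge v) = wedge [ffun a => h (v a)].
Proof.
apply: (ext_liftE (f := fun v => wedge [ffun a => h (v a)])).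
have [wm wa] := wedge_alternating r W; split=> [u a c x y|u a b ab uab].
  have E z : [ffun b => h (upd u a z b)] = upd [ffun b => h (u b)] a (h z).
    by apply/ffunP => b; rewrite !ffunE; case: eqP.
  by rewrite !E linearP wm.
by apply: (wa _ a b) => //; rewrite !ffunE uab.
Qed.

Definition snoc (T : Type) (N : nat) (v : {ffun 'I_N -> T}) (w : T) :
    {ffun 'I_N.+1 -> T} :=
  [ffun a => if unlift ord_max a is Some b then v b else w].

(* v_1 /\ ... /\ v_N (x) w |-> v_1 /\ ... /\ v_N /\ w *)
Definition mu (N : nat) (V : vectType F) : 'Hom(tensor (ext N V) V, ext N.+1 V) :=
  tensor_lift (fun x w => ext_lift (fun v => wedge (snoc v w)) x).

Lemma muE N (V : vectType F) (v : {ffun 'I_N -> V}) w :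
  mu N V (tens (wedge v) w) = wedge (snoc v w).
Proof.
have sA u : alternating (fun v : {ffun 'I_N -> V} => wedge (snoc v u)).
  have [wm wa] := wedge_alternating N.+1 V; split=> [t a c x y|t a b ab tab].
    have E z : snoc (upd t a z) u = upd (snoc t u) (lift ord_max a) z.
      apply/ffunP => i; rewrite !ffunE; case: unliftP => [j ->|->].
        by rewrite ffunE (inj_eq lift_inj).
      by rewrite (negPf (neq_lift _ _)).
    by rewrite !E wm.
  apply: (wa _ (lift ord_max a) (lift ord_max b)).
    by rewrite (inj_eq lift_inj).
  by rewrite !ffunE !liftK.
rewrite /mu tensor_liftE ?(ext_liftE (f := fun v => wedge (snoc v w))) //.
split=> [u|x] c y z; first by rewrite linearP.
rewrite !ext_lift_linear scaler_sumr -big_split; apply: eq_bigr => S _ /=.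
have E u : snoc [ffun a => vb (S a)] u =
    upd (snoc [ffun a => vb (S a)] 0) ord_max u.
  apply/ffunP => i; rewrite !ffunE; case: unliftP => [j ->|->].
    by rewrite eq_sym (negPf (neq_lift _ _)).
  by rewrite eqxx.
rewrite (E (c *: y + z)) (wedge_alternating _ _).1 -!E scalerDr.
by rewrite !scalerA mulrC.
Qed.

Definition Delta (N : nat) (V : vectType F) : {vspace tensor (ext N V) V} :=
  lker (mu N V).

End Exterior.

Section Representations.

Variable F : fieldType.

(* GL_2(F) is the set of g : 'M[F]_2 with g \in unitmx *)
Record GL2rep := GL2Rep {
  rep_space :> vectType F;
  rep_act : 'M[F]_2 -> 'End(rep_space);
  rep_act1 : rep_act 1%:M = \1%VF;
  rep_actM : forall g h, g \in unitmx -> h \in unitmx ->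
    rep_act (g *m h) = (rep_act g \o rep_act h)%VF }.

Definition rep_isom (V W : GL2rep) (f : 'Hom(V, W)) :=
  bijective f /\
  forall g, g \in unitmx -> forall x, f (rep_act V g x) = rep_act W g (f x).

Lemma tensorR_act1 (V W : GL2rep) :
  tensor_map (rep_act V 1%:M) (rep_act W 1%:M) = \1%VF.
Proof.
by apply: tensor_hom_eq => v w; rewrite tensor_mapE !rep_act1 !id_lfunE.
Qed.

Lemma tensorR_actM (V W : GL2rep) g h : g \in unitmx -> h \in unitmx ->
  tensor_map (rep_act V (g *m h)) (rep_act W (g *m h)) =
  (tensor_map (rep_act V g) (rep_act W g) \o
   tensor_map (rep_act V h) (rep_act W h))%VF.
Proof.
move=> gu hu; apply: tensor_hom_eq => v w.
by rewrite comp_lfunE !tensor_mapE !rep_actM // !comp_lfunE.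
Qed.

Definition tensorR (V W : GL2rep) : GL2rep :=
  GL2Rep (tensorR_act1 V W) (@tensorR_actM V W).

Lemma extR_act1 r (V : GL2rep) : ext_map r (rep_act V 1%:M) = \1%VF.
Proof.
apply: ext_hom_eq => v; rewrite ext_mapE rep_act1 id_lfunE; congr wedge.
by apply/ffunP => a; rewrite ffunE id_lfunE.
Qed.

Lemma extR_actM r (V : GL2rep) g h : g \in unitmx -> h \in unitmx ->
  ext_map r (rep_act V (g *m h)) =
  (ext_map r (rep_act V g) \o ext_map r (rep_act V h))%VF.
Proof.
move=> gu hu; apply: ext_hom_eq => v.
rewrite comp_lfunE !ext_mapE rep_actM //; congr wedge.
by apply/ffunP => a; rewrite !ffunE comp_lfunE.
Qed.

Definition extR (r : nat) (V : GL2rep) : GL2rep :=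
  GL2Rep (extR_act1 r V) (@extR_actM r V).

Section Sub.
Variables (V : GL2rep) (U : {vspace V}).
Hypothesis U_stable : forall g x, g \in unitmx -> x \in U -> rep_act V g x \in U.

Definition subR_act (g : 'M[F]_2) : 'End(subvs_of U) :=
  linfun (fun x : subvs_of U => vsproj U (rep_act V g (vsval x))).

Lemma subR_actE g x : g \in unitmx -> vsval (subR_act g x) = rep_act V g (vsval x).
Proof.
move=> gu; pose a := fun x : subvs_of U => vsproj U (rep_act V g (vsval x)).
have al : linear a by move=> c y z; rewrite /a !linearP.
pose h := HB.pack_for {linear subvs_of U -> subvs_of U} a
  (GRing.isLinear.Build _ _ _ _ _ al).
rewrite /subR_act -[linfun _]/(linfun h) lfunE /= vsprojK //.
exact/U_stable/subvsP.
Qed.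

Lemma subR_act1 : subR_act 1%:M = \1%VF.
Proof.
by apply/lfunP => x; apply/val_inj; rewrite /= subR_actE ?unitmx1 // rep_act1 !id_lfunE.
Qed.

Lemma subR_actM g h : g \in unitmx -> h \in unitmx ->
  subR_act (g *m h) = (subR_act g \o subR_act h)%VF.
Proof.
move=> gu hu; apply/lfunP => x; apply/val_inj; rewrite /= comp_lfunE !subR_actE //.
  by rewrite rep_actM // comp_lfunE.
by rewrite unitmx_mul gu.
Qed.

Definition subR : GL2rep := GL2Rep subR_act1 subR_actM.
End Sub.

Lemma mu_equiv N (V : GL2rep) g :
  (mu N V \o rep_act (tensorR (extR N V) V) g)%VF =
  (rep_act (extR N.+1 V) g \o mu N V)%VF.
Proof.
apply: tensor_hom_eq => x w; rewrite !comp_lfunE /= tensor_mapE.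
rewrite [x]ext_span !linear_sum.
have tB := tensor_bilinear (ext N V) V.
under eq_bigr do rewrite linearZ /=.
rewrite !bilinear_suml // !linear_sum; apply: eq_bigr => S _.
rewrite !linearZ /=; congr (_ *: _); rewrite ext_mapE !muE ext_mapE.
congr wedge; apply/ffunP => a; rewrite !ffunE.
by case: unliftP => [j|] _; rewrite ?ffunE.
Qed.

Lemma Delta_stable N (V : GL2rep) g (x : tensorR (extR N V) V) :
  g \in unitmx -> x \in Delta N V ->
  rep_act (tensorR (extR N V) V) g x \in Delta N V.
Proof.
move=> _; rewrite !memv_ker => /eqP mx0.
have /lfunP/(_ x) := mu_equiv N V g.
by rewrite !comp_lfunE mx0 linear0 => ->.
Qed.

Definition DeltaR (N : nat) (V : GL2rep) : GL2rep :=
  @subR (tensorR (extR N V) V) (Delta N V) (@Delta_stable N V).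

Lemma detR_act1 n (V : GL2rep) : \det (1%:M : 'M[F]_2) ^+ n *: rep_act V 1%:M = \1%VF.
Proof. by rewrite det1 expr1n scale1r rep_act1. Qed.

Lemma detR_actM n (V : GL2rep) g h : g \in unitmx -> h \in unitmx ->
  \det (g *m h) ^+ n *: rep_act V (g *m h) =
  ((\det g ^+ n *: rep_act V g) \o (\det h ^+ n *: rep_act V h))%VF.
Proof.
move=> gu hu; rewrite rep_actM // det_mulmx exprMn -comp_lfunZl -comp_lfunZr.
by rewrite scalerA.
Qed.

(* det^n (x) V, carried by the vector space V itself *)
Definition detR (n : nat) (V : GL2rep) : GL2rep :=
  GL2Rep (detR_act1 n V) (@detR_actM n V).

End Representations.

Section SymmetricPowers.

Variable F : fieldType.

(* X = 'X_ord0 and Y = 'X_ord_max; g acts on E by its matrix on column vectors,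
   so X_j is mapped to \sum_i g i j X_i *)
Definition gl2_subst (g : 'M[F]_2) : 2.-tuple {mpoly F[2]} :=
  [tuple \sum_i g i j *: 'X_i | j < 2].

Lemma subst_homog c g (p : dhomog 2 F c) : (p : {mpoly F[2]}) \mPo gl2_subst g \is c.-homog.
Proof.
case: p => p /= pc; rewrite comp_mpolyE big_seq; apply: rpred_sum => m mp.
apply: rpredZ; have /dhomogP/(_ m mp) /= <- := pc.
rewrite mdegE; elim/big_rec2: _ => [|i e q _ qe]; first exact: dhomog1.
apply: dhomogM => //; suff h : tnth (gl2_subst g) i \is 1.-homog.
  by have := dhomogMn (m i) h; rewrite mul1n.
rewrite tnth_mktuple; apply: rpred_sum => j _; apply: rpredZ.
by rewrite dhomogX; apply/eqP; apply: mdeg1.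
Qed.

Definition sym_act (c : nat) (g : 'M[F]_2) : 'End(dhomog 2 F c) :=
  linfun (fun p => DHomog (subst_homog g p)).

Lemma sym_actE c g (p : dhomog 2 F c) :
  sym_act c g p = (p : {mpoly F[2]}) \mPo gl2_subst g :> {mpoly F[2]}.
Proof.
pose a (p : dhomog 2 F c) := DHomog (subst_homog g p).
have al : linear a by move=> k x y; apply/val_inj; rewrite /= linearP.
pose h := HB.pack_for {linear dhomog 2 F c -> dhomog 2 F c} a
  (GRing.isLinear.Build _ _ _ _ _ al).
by rewrite /sym_act -[linfun _]/(linfun h) lfunE.
Qed.

Lemma sym_act1 c : sym_act c 1%:M = \1%VF.
Proof.
apply/lfunP => p; apply/val_inj; rewrite /= sym_actE id_lfunE.
rewrite -[RHS]comp_mpoly_id; congr (_ \mPo _); apply: eq_from_tnth => j.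
rewrite !tnth_mktuple (bigD1 j) //= mxE eqxx scale1r big1 ?addr0 // => i ij.
by rewrite mxE (negPf ij) scale0r.
Qed.

Lemma sym_actM c g h : sym_act c (g *m h) = (sym_act c g \o sym_act c h)%VF.
Proof.
apply/lfunP => p; apply/val_inj; rewrite /= comp_lfunE !sym_actE.
rewrite (comp_mpolyEX _ (gl2_subst (g *m h))) (comp_mpolyEX _ (gl2_subst h)).
rewrite raddf_sum /=; apply: eq_bigr => m _.
rewrite comp_mpolyZ !comp_mpolyX rmorph_prod /=.
congr (_ *: _); apply: eq_bigr => j _; rewrite rmorphXn /= !tnth_mktuple.
congr (_ ^+ _); rewrite raddf_sum /=.
under [RHS]eq_bigr => k _ do
  rewrite comp_mpolyZ comp_mpolyXU -tnth_nth tnth_mktuple scaler_sumr.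
rewrite exchange_big; apply: eq_bigr => i _ /=.
rewrite mxE scaler_suml; apply: eq_bigr => k _.
by rewrite scalerA mulrC.
Qed.

Definition symR (c : nat) : GL2rep F :=
  @GL2Rep F (dhomog 2 F c) (sym_act c) (sym_act1 c)
    (fun g h _ _ => sym_actM c g h).

Lemma mono_homog c (i : 'I_c.+1) :
  ('X_ord0 ^+ (c - i) * 'X_ord_max ^+ i : {mpoly F[2]}) \is c.-homog.
Proof.
have h (j : 'I_2) k : ('X_j ^+ k : {mpoly F[2]}) \is k.-homog.
  suff hj : ('X_j : {mpoly F[2]}) \is 1.-homog.
    by have := dhomogMn k hj; rewrite mul1n.
  by rewrite dhomogX; apply/eqP; apply: mdeg1.
by have := dhomogM (h ord0 (c - i)%N) (h ord_max i); rewrite subnK // -ltnS.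
Qed.

Definition mono (c : nat) (i : 'I_c.+1) : symR c := DHomog (mono_homog i).

Lemma mono_basis c : is_basis (@mono c).
Proof.
apply: spanning_basis; last by rewrite card_ord -[dim _]/('C(c + 1, c)) addn1 binSn.
pose mm (i : 'I_c.+1) : 'X_{1..2} := (U_(ord0) *+ (c - i) + U_(ord_max) *+ i)%MM.
have monoE (i : 'I_c.+1) :
    'X_ord0 ^+ (c - i) * 'X_ord_max ^+ i = 'X_[mm i] :> {mpoly F[2]}.
  by rewrite /mm mpolyXD !mpolyXn.
have mmdeg i : mdeg (mm i) = c.
  by rewrite mdegD !mdegMn !mdeg1 !mul1n subnK // -ltnS.
have mm1 i : mm i ord_max = i :> nat.
  by rewrite mnmDE !mulmnE !mnm1E /= mul0n mul1n.
move=> p; exists (fun i => (p : dhomog 2 F c)@_(mm i)).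
apply/val_inj; rewrite /= raddf_sum /=; apply/mpolyP => m.
rewrite raddf_sum /=.
have E i : ((p : dhomog 2 F c)@_(mm i) *: ('X_ord0 ^+ (c - i) * 'X_ord_max ^+ i))@_m
    = (p : dhomog 2 F c)@_(mm i) * (mm i == m)%:R :> F.
  by rewrite mcoeffZ monoE mcoeffX.
under eq_bigr do rewrite E.
case: (mdeg m =P c) => [mc|/eqP mc]; last first.
  rewrite (dhomog_nemf_coeff (valP p) mc) big1 // => i _.
  by case: eqP => [mi|_]; rewrite ?mulr0 // -mi mmdeg eqxx in mc *.
have m1 : (m ord_max <= c)%N by rewrite -mc mdegE (bigD1 ord_max) //= leq_addr.
have mE : mm (Ordinal (m1 : m ord_max < c.+1)%N) = m.
  apply/mnmP => k; rewrite mnmDE !mulmnE !mnm1E /=.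
  have : (m ord0 + m ord_max = c)%N.
    by rewrite -mc mdegE big_ord_recl big_ord1; congr (_ + m _)%N; apply/val_inj.
  move=> <-; rewrite addnK; case: (unliftP ord0 k) => [l ->|-> //=].
    rewrite (_ : lift _ _ = ord_max) /= ?mul0n ?mul1n //.
    by apply/val_inj; case: l => -[].
  by rewrite mul1n mul0n addn0.
rewrite (bigD1 (Ordinal (m1 : m ord_max < c.+1)%N)) //= mE eqxx mulr1.
rewrite big1 ?addr0 // => i /eqP im; case: eqP => [mi|_]; last by rewrite mulr0.
by case: im; apply/val_inj => /=; rewrite -mi mm1.
Qed.

End SymmetricPowers.

Section Phi.

Variable F : fieldType.

Definition Fwedge (c r : nat) (i : {ffun 'I_r -> 'I_c.+1}) : extR r (symR F c) :=
  wedge [ffun a => mono F (i a)].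

Definition Ften (N d : nat) (i : {ffun 'I_N -> 'I_d.+1}) (j : 'I_d.+1) :
    tensorR (extR N (symR F d)) (symR F d) :=
  tens (Fwedge i) (mono F j).

Definition isum (r n : nat) (i : {ffun 'I_r -> 'I_n}) : nat := (\sum_a i a)%N.

Definition block (N d : nat) (k : incr N.+1 d.+2) : {set {ffun 'I_N -> 'I_d.+1}} :=
  [set i : {ffun 'I_N -> 'I_d.+1} |
    [forall a, (k (widen_ord (leqnSn N) a) <= i a)%N && (i a < k (lift ord0 a))%N]].

(* hence, in phi, neither the subtractions nor inord truncate *)
Lemma block_range (N d : nat) (s : 'I_N.-1.+1) (k : incr N.+1 d.+2) i :
  (0 < N)%N -> i \in block k ->
  (N + isum i <= s + isum k)%N /\ (s + isum k - N - isum i <= d)%N.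
Proof.
move=> N0; rewrite inE => /forallP ik.
have lo : (N + isum i <= isum k)%N.
  rewrite /isum big_ord_recl; apply: leq_trans (leq_addl _ _).
  rewrite -{1}[N]card_ord -sum1_card -big_split /=; apply: leq_sum => a _.
  by have /andP[] := ik a.
have hi : (isum k <= isum i + d.+1)%N.
  rewrite /isum big_ord_recr /=; apply: leq_add; last by rewrite -ltnS.
  by apply: leq_sum => a _; have /andP[] := ik a.
split; first exact: leq_trans lo (leq_addl _ _).
have sN : (s < N)%N by rewrite -[X in (_ < X)%N](prednK N0).
rewrite -subnDA leq_subLR.
apply: leq_trans (leq_add (leqnn s) hi) _.
by rewrite addnS addnS -addSn -addnA leq_add2r.
Qed.

Definition phi (N d : nat) :
    'Hom(tensorR (symR F N.-1) (extR N.+1 (symR F d.+1)),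
         tensorR (extR N (symR F d)) (symR F d)) :=
  linext
    (fun p : 'I_N.-1.+1 * incr N.+1 d.+2 =>
       tens (mono F p.1) (Fwedge (p.2 : incr N.+1 d.+2)))
    (fun p : 'I_N.-1.+1 * incr N.+1 d.+2 => \sum_(i in block p.2)
       Ften i (inord (p.1 + isum p.2 - N - isum i))).

Lemma phiE (N d : nat) (s : 'I_N.-1.+1) (k : incr N.+1 d.+2) :
  phi N d (tens (mono F s) (Fwedge k)) =
  \sum_(i in block k) Ften i (inord (s + isum k - N - isum i)).
Proof.
apply: (linextE _ (s, k)).
exact: (tensor_basis (mono_basis F N.-1) (ext_basis N.+1 (mono_basis F d.+1))).
Qed.

End Phi.

(* Main.v *)
Require Import Defs.
From HB Require Import structures.
From mathcomp Require Import all_boot all_order all_fingroup all_algebra.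
From mathcomp Require Import mpoly.
From mathcomp Require Import zify ring.

(** Evaluation at formal points turns all the spaces involved into spaces of
polynomials, where [phi] becomes a division.  A point is a pair P = (x, y) of
elements of a polynomial ring over F; a form p of degree c takes the value
p(x, y) at it, a wedge of forms v_1, ..., v_r takes the value det (v_b(P_a)) at
a family of points P_1, ..., P_r, and tensors are evaluated factor by factor.
Write [P, Q] for the determinant of a pair of points.  The key identity
([eval_phi]), for Q with nonzero first coordinate, is

  ([P_1, Q] ... [P_N, Q]) * (phi (g (x) w))(P_1, ..., P_N; Q)
    = g(Q) * w(P_1, ..., P_N, Q).

It holds because a sum over the box [block k] of determinants is a determinant
whose b-th column is a sum over the interval from k_b to k_{b+1}; this sum is
geometric, multiplication by [P_a, Q] makes it telescope, and the resulting
differences of consecutive columns are what column operations produce from the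
(N+1) x (N+1) determinant that evaluates w.

Everything follows by evaluation at generic points (1, t_a), where evaluation
is injective because the strictly increasing exponents of an alternant in the
t_a can be read off from its diagonal monomial ([alternant_coeff]).

- Equivariance ([phi_act]): an element of GL_2 moves the points and multiplies
  every bracket by its determinant, so the N brackets produce det^N.

- Injectivity ([phi_inj]): let q be the polynomial of degree less than N whose
  s-th coefficient is the value of w_s, where x is the sum of the X^{N-1-s} Y^s
  (x) w_s.  Letting each of the N+1 points play the role of Q in the key
  identity shows that, if x is in the kernel, then q vanishes at t_1, ...,
  t_{N+1}; hence q = 0 and all the w_s vanish.

- Image in the kernel of mu ([phi_in_Delta]): expanding a determinant along its
  last column expresses the value of [mu y] through the N+1 values of y that
  have one of the points in the role of Q.  For y = phi x these are quotients
  of the values of q by products of differences, and their sum is the Nth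
  divided difference of q, which is 0.

- Surjectivity onto the kernel of mu: both spaces have the same dimension, as
  mu is surjective and N C(n+1, N+1) + C(n, N+1) = n C(n, N). *)

Set Implicit Arguments.
Unset Strict Implicit.
Unset Printing Implicit Defensive.

Import GRing.Theory VectorInternalTheory.
Local Open Scope ring_scope.

(** * Determinants *)

Section Determinants.

Variable R : comNzRingType.

Lemma det_2x2 (A : 'M[R]_2) :
  \det A = A ord0 ord0 * A ord_max ord_max - A ord0 ord_max * A ord_max ord0.
Proof.
rewrite (expand_det_row A ord0) big_ord_recl big_ord1 /cofactor !det_mx11 !mxE.
have -> : lift ord0 0 = ord_max :> 'I_2 by apply/val_inj.
have -> : lift ord_max 0 = ord0 :> 'I_2 by apply/val_inj.
by rewrite /= expr0 expr1 mul1r mulN1r mulrN.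
Qed.

(** Multilinearity in all columns at once: choosing a summand in every column is
choosing a point of a box, which is how the sums defining [phi] become single
determinants. *)
Lemma det_sum_columns N (I : finType) (Q : 'I_N -> pred I)
    (G : 'I_N -> 'I_N -> I -> R) :
  \sum_(i : {ffun 'I_N -> I} | [forall b, Q b (i b)])
     \det (\matrix_(a, b) G a b (i b)) =
  \det (\matrix_(a, b) \sum_(j | Q b j) G a b j).
Proof.
rewrite -[RHS]det_tr; under eq_bigr do rewrite -det_tr.
rewrite exchange_big /=; apply: eq_bigr => s _; rewrite -mulr_sumr; congr (_ * _).
under [RHS]eq_bigr do rewrite !mxE.
rewrite bigA_distr_big_dep; apply: eq_big => [i|i _].
  exact/forallP/familyP.
by apply: eq_bigr => b _; rewrite !mxE.
Qed.

Lemma det_scale_rows N (c : 'I_N -> R) (B : 'M[R]_N) :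
  (\prod_a c a) * \det B = \det (\matrix_(a, b) (c a * B a b)).
Proof.
have -> : \matrix_(a, b) (c a * B a b) = diag_mx (\row_a c a) *m B.
  by apply/matrixP => a b; rewrite mul_diag_mx !mxE.
by rewrite det_mulmx det_diag; under [in RHS]eq_bigr do rewrite mxE.
Qed.

Lemma det_move_row N (A B : 'M[R]_N.+1) (b : 'I_N.+1) :
  (forall c, B ord_max c = A b c) ->
  (forall a c, B (lift ord_max a) c = A (lift b a) c) ->
  \det B = (-1) ^+ (b + N) * \det A.
Proof.
move=> rB rB'; rewrite (expand_det_row B ord_max) (expand_det_row A b) mulr_sumr.
apply: eq_bigr => c _; rewrite /cofactor rB.
have -> : row' ord_max (col' c B) = row' b (col' c A).
  by apply/matrixP => i j; rewrite !mxE rB'.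
rewrite [RHS]mulrCA; congr (_ * _); rewrite mulrA -exprD; congr (_ * _).
by rewrite -signr_odd -[RHS]signr_odd !oddD /=; do 3! case: odd.
Qed.

(** A homogeneous geometric sum: with T_i = x^(d+1-i) y^i u^(i-k) w^(k'-i), the
i-th term multiplied by x w - y u is T_i - T_(i+1). *)
Lemma telescope_geometric d k k' (x y u w : R) : (k <= k' <= d.+1)%N ->
  (x * w - y * u) * (\sum_(i < d.+1 | (k <= i < k')%N)
     x ^+ (d - i) * y ^+ i * (u ^+ (i - k) * w ^+ (k'.-1 - i))) =
  x ^+ (d.+1 - k) * y ^+ k * w ^+ (k' - k)
  - x ^+ (d.+1 - k') * y ^+ k' * u ^+ (k' - k).
Proof.
move=> /andP[kk' k'd].
pose T i := - (x ^+ (d.+1 - i) * y ^+ i * (u ^+ (i - k) * w ^+ (k' - i))).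
transitivity (T k' - T k); last by rewrite /T !subnn !expr0; ring.
rewrite -telescope_sumr // mulr_sumr (big_nat_widen _ _ d.+1) //.
rewrite big_geq_mkord; apply: eq_big => [i|i /andP[ki ik']]; first by rewrite andbC.
rewrite /T; have -> : (d.+1 - i = (d - i).+1)%N by lia.
have -> : (k' - i = (k'.-1 - i).+1)%N by lia.
have -> : (i.+1 - k = (i - k).+1)%N by lia.
have -> : (d.+1 - i.+1 = d - i)%N by lia.
have -> : (k' - i.+1 = k'.-1 - i)%N by lia.
by rewrite !exprS; ring.
Qed.

(** Replacing every column but the first by a combination of two neighbouring
columns of M that vanishes in the last row leaves that row with a single entry,
along which the determinant is expanded. *)
Lemma det_difference_columns N (M : 'M[R]_N.+1) (p q : 'I_N -> R) :
  (forall b, p b * M ord_max (widen_ord (leqnSn N) b)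
             = q b * M ord_max (lift ord0 b)) ->
  (\prod_b q b) * \det M = M ord_max ord0 *
    \det (\matrix_(a, b) (p b * M (lift ord_max a) (widen_ord (leqnSn N) b)
                          - q b * M (lift ord_max a) (lift ord0 b))).
Proof.
move=> pq.
(* M *m C is M after the column operations; C is triangular, with diagonal
   entries 1, - q_0, - q_1, etc., and its sign (-1)^N cancels the sign of the
   cofactor of the lower left corner. *)
pose C : 'M[R]_N.+1 := \matrix_(i, j)
  if unlift ord0 j is Some b
  then p b *+ (i == widen_ord (leqnSn N) b) - q b *+ (i == lift ord0 b)
  else (i == ord0)%:R.
have MC0 a : (M *m C) a ord0 = M a ord0.
  rewrite mxE (bigD1 ord0) //= mxE unlift_none eqxx mulr1 big1 ?addr0 // => i i0.
  by rewrite mxE unlift_none (negPf i0) mulr0.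
have MC1 a b : (M *m C) a (lift ord0 b) =
    p b * M a (widen_ord (leqnSn N) b) - q b * M a (lift ord0 b).
  rewrite mxE; under eq_bigr => i _ do
    rewrite mxE liftK mulrBr !mulrnAr.
  rewrite sumrB (bigD1 (widen_ord (leqnSn N) b)) //= eqxx mulr1n.
  rewrite [X in _ + X - _]big1 => [|i /negPf ->] //.
  rewrite (bigD1 (lift ord0 b)) //= eqxx mulr1n.
  rewrite [X in _ - (_ + X)]big1 => [|i /negPf ->] //.
  by rewrite !addr0 ![M _ _ * _]mulrC.
have detC : \det C = (-1) ^+ N * \prod_b q b.
  rewrite -det_tr det_trig; last first.
    apply/is_trig_mxP => i j ij; rewrite !mxE.
    case: unliftP ij => [b ->|->] // ij.
      have -> : (j == widen_ord (leqnSn N) b) = false.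
        apply/eqP => jb; move: ij; rewrite jb /= /bump /=; lia.
      have -> : (j == lift ord0 b) = false.
        by apply/eqP => jb; move: ij; rewrite jb ltnn.
      by rewrite subr0.
    by case: eqP ij => // ->.
  rewrite big_ord_recl !mxE unlift_none eqxx mul1r.
  have := prodrN (predT : {pred 'I_N}) q; rewrite card_ord => <-; apply: eq_bigr => b _.
  rewrite !mxE liftK eqxx (_ : (_ == _) = false) ?sub0r //.
  by apply/eqP => /(congr1 val) /=; rewrite /bump /=; lia.
have := det_mulmx M C; rewrite detC.
rewrite (expand_det_row (M *m C) ord_max) (bigD1 ord0) //=.
rewrite big1 => [|c c0]; last first.
  case: (unliftP ord0 c) c0 => [b ->|->]; last by rewrite eqxx.
  by rewrite MC1 pq subrr mul0r.
rewrite addr0 MC0 /cofactor /= addn0 => E.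
have -> : \matrix_(a, b) (p b * M (lift ord_max a) (widen_ord (leqnSn N) b)
     - q b * M (lift ord_max a) (lift ord0 b)) = row' ord_max (col' ord0 (M *m C)).
  by apply/matrixP => a b; rewrite 3!mxE -MC1.
apply: (can_inj (signrMK N)) => /=.
by rewrite mulrA mulrC -E mulrCA.
Qed.

End Determinants.

Section Vandermonde.

Variables (R : comNzRingType) (N : nat) (t : 'I_N.+1 -> R).

Let A : 'M[R]_N.+1 := \matrix_(b, s) t b ^+ s.

(** Divided differences without denominators: up to the factor [\det A], the
cofactors of the last column of a Vandermonde matrix compute the top coefficient
of a polynomial from its values at the nodes. *)
Lemma sum_horner_cofactor (p : {poly R}) : (size p <= N.+1)%N ->
  \sum_b p.[t b] * cofactor A b ord_max = p`_N * \det A.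
Proof.
move=> sp.
transitivity (\sum_(s < N.+1) p`_s * \sum_b cofactor A b ord_max * A b s).
  under [RHS]eq_bigr do rewrite mulr_sumr.
  rewrite exchange_big; apply: eq_bigr => b _ /=.
  rewrite (horner_coef_wide _ sp) mulr_suml; apply: eq_bigr => s _.
  by rewrite [A b s]mxE [cofactor _ _ _ * _]mulrC [RHS]mulrA.
have adjE s : \sum_b cofactor A b ord_max * A b s = \det A *+ (ord_max == s).
  have /matrixP/(_ ord_max s) := mul_adj_mx A; rewrite !mxE => <-.
  by apply: eq_bigr => b _; rewrite [\adj _ _ _]mxE.
rewrite (bigD1 ord_max) //= adjE eqxx mulr1n big1 ?addr0 // => s sm.
by rewrite adjE eq_sym (negPf sm) mulr0.
Qed.

(** The case of the monic polynomial vanishing at all the nodes but [t b]. *)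
Lemma cofactor_prod (b : 'I_N.+1) :
  (\prod_(a < N) (t b - t (lift b a))) * cofactor A b ord_max = \det A.
Proof.
pose p := \prod_(a < N) ('X - (t (lift b a))%:P).
have sp : size p = N.+1 by rewrite size_prod_XsubC /index_enum unlock -enumT size_enum_ord.
have := sum_horner_cofactor (eq_leq sp).
have -> : p`_N = 1.
  have /monicP := monic_prod_XsubC (index_enum 'I_N) predT (fun a => t (lift b a)).
  by rewrite lead_coefE sp.
rewrite mul1r => <-; rewrite (bigD1 b) //= [X in _ = _ + X]big1 => [|c cb].
  by rewrite addr0 horner_prod; under [in RHS]eq_bigr do rewrite hornerXsubC.
rewrite horner_prod; case: (unliftP b c) cb => [a -> _|->]; last by rewrite eqxx.
by rewrite (bigD1 a) //= hornerXsubC subrr !mul0r.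
Qed.

End Vandermonde.

Lemma det_Vandermonde_neq0 (R : idomainType) N (t : 'I_N -> R) :
  injective t -> \det (\matrix_(b < N, s < N) t b ^+ s) != 0.
Proof.
move=> t_inj; rewrite (_ : \matrix_(b, s) _ = (Vandermonde N (\row_b t b))^T); last first.
  by apply/matrixP => b s; rewrite !mxE.
rewrite det_tr det_Vandermonde; apply/prodf_neq0 => i _; apply/prodf_neq0 => j ij.
rewrite !mxE subr_eq0 (inj_eq t_inj); apply/eqP => e.
by rewrite e ltnn in ij.
Qed.

(** * Evaluating exterior powers and tensors *)

Section Evaluation.

Variables (F : fieldType) (n : nat).
Local Notation R := {mpoly F[n]}.

(** The value of [x] at a family of linear forms, through the coordinates of
[x]; that a wedge takes a determinant as its value is [ext_eval_wedge]. *)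
Definition ext_eval (r : nat) (V : vectType F) (l : 'I_r -> {linear V -> R})
    (x : ext r V) : R :=
  \sum_S (x : {ffun _ -> F^o}) S *: \det (\matrix_(a, b) l a (vb (S b))).

Lemma ext_eval_is_linear r (V : vectType F) (l : 'I_r -> {linear V -> R}) :
  linear (ext_eval l).
Proof.
move=> c x y; rewrite /ext_eval scaler_sumr -big_split; apply: eq_bigr => S _ /=.
by rewrite !ffunE scalerDl scalerA.
Qed.

HB.instance Definition _ r (V : vectType F) (l : 'I_r -> {linear V -> R}) :=
  GRing.isLinear.Build F (ext r V) R _ (ext_eval l) (ext_eval_is_linear l).

(** [ext_lift] requires a finite dimensional codomain, which polynomials are not;
each single coefficient of the determinant is an alternating map to the field,
so the universal property applies coefficient by coefficient. *)
Lemma ext_eval_wedge r (V : vectType F) (l : 'I_r -> {linear V -> R})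
    (v : {ffun 'I_r -> V}) :
  ext_eval l (wedge v) = \det (\matrix_(a, b) l a (v b)).
Proof.
apply/mpolyP => m.
pose f (v : {ffun 'I_r -> V}) : F^o := (\det (\matrix_(a, b) l a (v b)))@_m.
have fA : alternating f.
  split=> [u a c x y|u a b ab uab]; rewrite /f -![\det (\matrix_(_, _) _)]det_tr.
    rewrite (determinant_multilinear (i0 := a) (b := c%:MP) (c := 1)
      (B := (\matrix_(a0, b) l a0 (upd u a x b))^T)
      (C := (\matrix_(a0, b) l a0 (upd u a y b))^T)).
    - by rewrite mul1r mcoeffD mcoeffCM.
    - by apply/rowP => j; rewrite !mxE !ffunE eqxx linearP mul1r mul_mpolyC.
    - by apply/matrixP => i j; rewrite !mxE !ffunE eq_sym (negPf (neq_lift _ _)).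
    - by apply/matrixP => i j; rewrite !mxE !ffunE eq_sym (negPf (neq_lift _ _)).
  rewrite (determinant_alternate ab) ?mcoeff0 // => j; by rewrite !mxE uab.
rewrite -[RHS]/(f v) -(ext_liftE _ fA) ext_lift_linear /ext_eval raddf_sum /=.
apply: eq_bigr => S _; rewrite mcoeffZ; congr (_ * _@_m); congr (\det _).
by apply/matrixP => a b; rewrite !mxE ffunE.
Qed.

Definition tensor_eval (V W : vectType F) (al : {linear V -> R})
    (be : {linear W -> R}) (x : tensor V W) : R :=
  \sum_i \sum_j (x : 'M[F]_(_, _)) i j *: (al (vb i) * be (vb j)).

Lemma tensor_eval_is_linear (V W : vectType F) (al : {linear V -> R})
  (be : {linear W -> R}) : linear (tensor_eval al be).
Proof.
move=> c x y; rewrite /tensor_eval scaler_sumr -big_split; apply: eq_bigr => i _ /=.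
rewrite scaler_sumr -big_split; apply: eq_bigr => j _ /=.
by rewrite !mxE scalerDl scalerA.
Qed.

HB.instance Definition _ (V W : vectType F) (al : {linear V -> R})
    (be : {linear W -> R}) :=
  GRing.isLinear.Build F (tensor V W) R _ (tensor_eval al be)
    (tensor_eval_is_linear al be).

Lemma tensor_eval_tens (V W : vectType F) (al : {linear V -> R})
    (be : {linear W -> R}) v w :
  tensor_eval al be (tens v w) = al v * be w.
Proof.
rewrite {2}[v]vb_sum {2}[w]vb_sum !linear_sum /= mulr_suml.
apply: eq_bigr => i _; rewrite mulr_sumr; apply: eq_bigr => j _.
by rewrite /tens mxE big_ord1 !mxE !linearZ /= -scalerAl -scalerAr scalerA.
Qed.

End Evaluation.

Section Spanning.

Variables (F : fieldType) (U : lmodType F).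

Lemma tensor_linear_eq (V W : vectType F) (f g : {linear tensor V W -> U}) :
  (forall v w, f (tens v w) = g (tens v w)) -> f =1 g.
Proof.
move=> fg x; rewrite [x]tensor_span !linear_sum; apply: eq_bigr => i _.
by rewrite !linear_sum; apply: eq_bigr => j _; rewrite !linearZ /= fg.
Qed.

Lemma ext_linear_eq r (V : vectType F) (f g : {linear ext r V -> U}) :
  (forall v, f (wedge v) = g (wedge v)) -> f =1 g.
Proof.
move=> fg x; rewrite [x]ext_span !linear_sum; apply: eq_bigr => S _.
by rewrite !linearZ /= fg.
Qed.

End Spanning.

Section Functoriality.

Variables (F : fieldType) (n : nat).
Local Notation R := {mpoly F[n]}.

Lemma ext_eval_map r (V W : vectType F) (h : 'Hom(V, W))
    (l : 'I_r -> {linear W -> R}) (l' : 'I_r -> {linear V -> R}) x :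
  (forall a v, l a (h v) = l' a v) ->
  ext_eval l (ext_map r h x) = ext_eval l' x.
Proof.
move=> ll'; move: x.
apply: (ext_linear_eq (f := ext_eval l \o ext_map r h) (g := ext_eval l')) => v /=.
rewrite ext_mapE !ext_eval_wedge; congr (\det _).
by apply/matrixP => a b; rewrite !mxE ffunE.
Qed.

Lemma tensor_eval_map (V W V' W' : vectType F) (g : 'Hom(V, V')) (h : 'Hom(W, W'))
    (al' : {linear V' -> R}) (be' : {linear W' -> R})
    (al : {linear V -> R}) (be : {linear W -> R}) x :
  (forall v, al' (g v) = al v) -> (forall w, be' (h w) = be w) ->
  tensor_eval al' be' (tensor_map g h x) = tensor_eval al be x.
Proof.
move=> ga hb; move: x.
apply: (tensor_linear_eq (f := tensor_eval al' be' \o tensor_map g h)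
  (g := tensor_eval al be)) => v w /=.
by rewrite tensor_mapE !tensor_eval_tens ga hb.
Qed.

End Functoriality.

Lemma tensor_wedge_linear_eq (F : fieldType) (U : lmodType F) r (V W : vectType F)
    (f g : {linear tensor (ext r V) W -> U}) :
  (forall v w, f (tens (wedge v) w) = g (tens (wedge v) w)) -> f =1 g.
Proof.
move=> fg; apply: tensor_linear_eq => x w.
have tB := tensor_bilinear (ext r V) W.
rewrite [x]ext_span bilinear_suml // !linear_sum; apply: eq_bigr => S _.
by rewrite !linearZ fg.
Qed.

(** On a tensor [wedge v] (x) [w] this is the expansion of the determinant along
the column of [w], the last one. *)
Lemma ext_eval_mu (F : fieldType) n N (V : vectType F)
    (l : 'I_N.+1 -> {linear V -> {mpoly F[n]}}) (x : tensor (ext N V) V) :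
  ext_eval l (mu N V x) = \sum_(b < N.+1) (-1) ^+ (b + N) *
    tensor_eval (ext_eval (fun a => l (lift b a))) (l b) x.
Proof.
pose g x : {mpoly F[n]} := \sum_(b < N.+1) (-1) ^+ (b + N) *
    tensor_eval (ext_eval (fun a => l (lift b a))) (l b) x.
have gl : linear g.
  move=> c y z; rewrite /g scaler_sumr -big_split; apply: eq_bigr => b _ /=.
  by rewrite linearP mulrDr scalerAr.
pose h := HB.pack_for {linear tensor (ext N V) V -> {mpoly F[n]}} g
  (GRing.isLinear.Build _ _ _ _ _ gl).
rewrite -[RHS]/(h x); move: x.
apply: (tensor_wedge_linear_eq (f := ext_eval l \o mu N V) (g := h)) => v w /=.
rewrite muE ext_eval_wedge (expand_det_col _ ord_max) /g; apply: eq_bigr => b _.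
rewrite tensor_eval_tens /= ext_eval_wedge !mxE ffunE unlift_none /cofactor.
have -> : row' b (col' ord_max (\matrix_(a, b0) l a (snoc v w b0)))
    = \matrix_(a, b0) l (lift b a) (v b0).
  by apply/matrixP => i j; rewrite !mxE ffunE liftK.
by rewrite [LHS]mulrC -[LHS]mulrA.
Qed.

Lemma ext_eval_eq (F : fieldType) n r (V : vectType F)
    (l l' : 'I_r -> {linear V -> {mpoly F[n]}}) :
  (forall a, l a =1 l' a) -> ext_eval l =1 ext_eval l'.
Proof.
move=> ll' x; apply: eq_bigr => S _; congr (_ *: \det _).
by apply/matrixP => a b; rewrite !mxE ll'.
Qed.

Lemma tensor_eval_eq (F : fieldType) n (V W : vectType F)
    (al al' : {linear V -> {mpoly F[n]}}) (be be' : {linear W -> {mpoly F[n]}}) :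
  al =1 al' -> be =1 be' -> tensor_eval al be =1 tensor_eval al' be'.
Proof.
by move=> ea eb x; apply: eq_bigr => i _; apply: eq_bigr => j _; rewrite ea eb.
Qed.

(** * The key identity *)

Section Points.

Variables (F : fieldType) (n : nat).
Local Notation R := {mpoly F[n]}.
Local Notation point := (2.-tuple R).
Implicit Types P Q : point.

Definition fstc P : R := tnth P ord0.
Definition sndc P : R := tnth P ord_max.

(** The determinant of two points of the plane, the basic SL_2-invariant. *)
Definition bracket P Q : R := fstc P * sndc Q - sndc P * fstc Q.

Definition sym_eval c P (p : symR F c) : R := (p : dhomog 2 F c) \mPo P.

Lemma sym_eval_is_linear c P : linear (@sym_eval c P).
Proof. by move=> k x y; rewrite /sym_eval linearP. Qed.

HB.instance Definition _ c P :=
  GRing.isLinear.Build F (symR F c) R _ (@sym_eval c P) (sym_eval_is_linear P).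

Lemma sym_eval_mono c P (i : 'I_c.+1) :
  sym_eval P (mono F i) = fstc P ^+ (c - i) * sndc P ^+ i.
Proof.
by rewrite /sym_eval /= rmorphM !rmorphXn /= !comp_mpolyXU -!tnth_nth.
Qed.

Definition wedge_eval r c (P : {ffun 'I_r -> point}) : ext r (symR F c) -> R :=
  ext_eval (fun a => @sym_eval c (P a)).

HB.instance Definition _ r c (P : {ffun 'I_r -> point}) :=
  GRing.Linear.on (@wedge_eval r c P).

(** [Q] is both the point at which the symmetric factor is evaluated and the last
of the points at which the exterior factor is. *)
Definition eval_source N d (P : {ffun 'I_N -> point}) Q :
    tensorR (symR F N.-1) (extR N.+1 (symR F d.+1)) -> R :=
  tensor_eval (@sym_eval N.-1 Q) (@wedge_eval N.+1 d.+1 (snoc P Q)).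

Definition eval_target N d (P : {ffun 'I_N -> point}) Q :
    tensorR (extR N (symR F d)) (symR F d) -> R :=
  tensor_eval (@wedge_eval N d P) (@sym_eval d Q).

HB.instance Definition _ N d (P : {ffun 'I_N -> point}) Q :=
  GRing.Linear.on (@eval_source N d P Q).
HB.instance Definition _ N d (P : {ffun 'I_N -> point}) Q :=
  GRing.Linear.on (@eval_target N d P Q).

Lemma wedge_eval_Fwedge r c (P : {ffun 'I_r -> point}) (k : {ffun 'I_r -> 'I_c.+1}) :
  wedge_eval P (Fwedge F k)
  = \det (\matrix_(a, b) (fstc (P a) ^+ (c - k b) * sndc (P a) ^+ k b)).
Proof.
rewrite /wedge_eval ext_eval_wedge; congr (\det _).
by apply/matrixP => a b; rewrite !mxE ffunE -sym_eval_mono.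
Qed.

Lemma eval_target_Ften N d (P : {ffun 'I_N -> point}) Q i (j : 'I_d.+1) :
  eval_target P Q (Ften F i j) =
  \det (\matrix_(a, b) (fstc (P a) ^+ (d - i b) * sndc (P a) ^+ i b))
  * (fstc Q ^+ (d - j) * sndc Q ^+ j).
Proof.
by rewrite /eval_target tensor_eval_tens -sym_eval_mono -wedge_eval_Fwedge.
Qed.

Lemma source_basis N d :
  is_basis (fun p : 'I_N.-1.+1 * incr N.+1 d.+2 =>
    tens (mono F p.1) (Fwedge F (p.2 : incr N.+1 d.+2))).
Proof.
exact: (tensor_basis (mono_basis F N.-1) (ext_basis N.+1 (mono_basis F d.+1))).
Qed.

(** The exponents of u and w in a summand of [phi] split into a part independent
of [i] and one factor for each column, so that the sum over the block can be
taken column by column. *)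
Lemma block_monomial N d (s : 'I_N.-1.+1) (k : incr N.+1 d.+2) i (u w : R) :
  (0 < N)%N -> i \in block k ->
  let j := inord (s + isum k - N - isum i) : 'I_d.+1 in
  u ^+ (d - j) * w ^+ j =
  u ^+ (N.-1 - s) * w ^+ s * (u ^+ (d.+1 - k ord_max) * w ^+ k ord0) *
  \prod_b (u ^+ (i b - k (widen_ord (leqnSn N) b))
           * w ^+ ((k (lift ord0 b)).-1 - i b)).
Proof.
move=> N0 ik j; have [lo hi] := block_range s N0 ik.
have jE : j = (s + isum k - N - isum i)%N :> nat by rewrite inordK // ltnS.
have sN : (s <= N.-1)%N by rewrite -ltnS.
move: ik; rewrite inE => /forallP ik.
have kd : (k ord_max <= d.+1)%N by rewrite -ltnS.
have kE0 : isum k = (k ord0 + \sum_b k (lift ord0 b))%N.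
  by rewrite /isum big_ord_recl.
have kE1 : isum k = (\sum_b k (widen_ord (leqnSn N) b) + k ord_max)%N.
  by rewrite /isum big_ord_recr.
have uE : (\sum_b (i b - k (widen_ord (leqnSn N) b))
    = isum i - \sum_b k (widen_ord (leqnSn N) b))%N.
  by rewrite sumnB // => b _; have /andP[] := ik b.
have wE : (\sum_b ((k (lift ord0 b)).-1 - i b)
    = \sum_b k (lift ord0 b) - N - isum i)%N.
  rewrite sumnB; last by move=> b _; have /andP[_ h] := ik b; rewrite -ltnS (ltn_predK h).
  congr (_ - _)%N; under eq_bigr do rewrite -subn1.
  rewrite sumnB ?sum1_card ?card_ord // => b _.
  by have /andP[_ h] := ik b; rewrite (leq_ltn_trans _ h).
have ui : (\sum_b k (widen_ord (leqnSn N) b) <= isum i)%N.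
  by apply: leq_sum => b _; have /andP[] := ik b.
have wi : (N + isum i <= \sum_b k (lift ord0 b))%N.
  rewrite -{1}[N]card_ord -sum1_card -big_split /=; apply: leq_sum => b _.
  by have /andP[] := ik b.
rewrite big_split /= !prodrXr uE wE.
rewrite [X in _ = X * _]mulrACA [RHS]mulrACA -!exprD jE.
by congr (_ ^+ _ * _ ^+ _); lia.
Qed.

(** The column factors of [block_monomial] turn the sum over the block into a
determinant of geometric sums, which telescope against the brackets;
[det_difference_columns] recognizes the result.  The first coordinate of [Q]
must be nonzero because the column operations multiply the determinant by a
power of it. *)
Lemma eval_phi_basis N d (P : {ffun 'I_N -> point}) Q
    (s : 'I_N.-1.+1) (k : incr N.+1 d.+2) :
  (0 < N)%N -> fstc Q != 0 ->
  (\prod_a bracket (P a) Q) *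
    eval_target P Q (phi F N d (tens (mono F s) (Fwedge F k)))
  = eval_source P Q (tens (mono F s) (Fwedge F k)).
Proof.
move=> N0 Q0; rewrite phiE linear_sum /=.
set u := fstc Q in Q0 *; set w := sndc Q.
pose kl (b : 'I_N) := k (widen_ord (leqnSn N) b); pose kr (b : 'I_N) := k (lift ord0 b).
pose G a b (i : 'I_d.+1) := fstc (P a) ^+ (d - i) * sndc (P a) ^+ i *
  (u ^+ (i - kl b) * w ^+ ((kr b).-1 - i)).
have klr b : (kl b <= kr b <= d.+1)%N.
  apply/andP; split; last by rewrite -ltnS ltn_ord.
  by apply/ltnW/incr_lt; rewrite /= /bump /=; lia.
have detG i : i \in block k ->
    eval_target P Q (Ften F i (inord (s + isum k - N - isum i))) =
    (u ^+ (N.-1 - s) * w ^+ s * (u ^+ (d.+1 - k ord_max) * w ^+ k ord0))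
    * \det (\matrix_(a, b) G a b (i b)).
  move=> ik; rewrite eval_target_Ften block_monomial //.
  rewrite mulrCA; congr (_ * _).
  rewrite mulrC -[X in _ * X]det_tr det_scale_rows -[RHS]det_tr; congr (\det _).
  by apply/matrixP => a b; rewrite !mxE mulrC.
rewrite (eq_bigr _ detG) -mulr_sumr.
have -> : \sum_(i in block k) \det (\matrix_(a, b) G a b (i b)) =
    \det (\matrix_(a, b) \sum_(j < d.+1 | (kl b <= j < kr b)%N) G a b j).
  by rewrite -det_sum_columns; apply: eq_bigl => i; rewrite inE.
rewrite mulrCA det_scale_rows.
rewrite /eval_source tensor_eval_tens /= sym_eval_mono wedge_eval_Fwedge -[LHS]mulrA.
congr (_ * _).
pose M : 'M[R]_N.+1 := \matrix_(a, b)
  (fstc (snoc P Q a) ^+ (d.+1 - k b) * sndc (snoc P Q a) ^+ k b).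
rewrite -/M.
have Mmax b : M ord_max b = u ^+ (d.+1 - k b) * w ^+ k b.
  by rewrite mxE ffunE unlift_none.
have Mlift a b : M (lift ord_max a) b =
    fstc (P a) ^+ (d.+1 - k b) * sndc (P a) ^+ k b.
  by rewrite mxE ffunE liftK.
(* the combinations of neighbouring columns vanish at Q itself *)
have pq b : w ^+ (kr b - kl b) * M ord_max (widen_ord (leqnSn N) b) =
    u ^+ (kr b - kl b) * M ord_max (lift ord0 b).
  rewrite !Mmax -/(kl b) -/(kr b) mulrCA [RHS]mulrA -!exprD.
  by have ? := klr b; congr (_ ^+ _ * _ ^+ _); lia.
have := det_difference_columns pq; rewrite Mmax => E.
have uE : \prod_b u ^+ (kr b - kl b) = u ^+ (k ord_max - k ord0).
  rewrite prodrXr sumnB; last by move=> b _; have /andP[] := klr b.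
  have kE0 : isum k = (k ord0 + \sum_b kr b)%N by rewrite /isum big_ord_recl.
  have kE1 : isum k = (\sum_b kl b + k ord_max)%N by rewrite /isum big_ord_recr.
  by congr (_ ^+ _); lia.
apply: (mulfI (expf_neq0 (k ord_max - k ord0) Q0)).
rewrite -uE E uE !mulrA -exprD.
have k0m : (k ord0 <= k ord_max <= d.+1)%N.
  rewrite -[X in _ && X]ltnS ltn_ord andbT.
  exact/ltnW/incr_lt.
have -> : (k ord_max - k ord0 + (d.+1 - k ord_max) = d.+1 - k ord0)%N by lia.
congr (_ * _ * _); congr (\det _).
apply/matrixP => a b; rewrite [LHS]mxE [X in _ * X]mxE telescope_geometric //.
by rewrite -!Mlift [RHS]mxE; congr (_ - _); rewrite mulrC.
Qed.

Lemma eval_phi N d (P : {ffun 'I_N -> point}) Q x : (0 < N)%N -> fstc Q != 0 ->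
  (\prod_a bracket (P a) Q) * eval_target P Q (phi F N d x) = eval_source P Q x.
Proof.
move=> N0 Q0; have [c ->] := basis_spanning (source_basis N d) x.
rewrite !linear_sum /= mulr_sumr; apply: eq_bigr => -[s k] _.
by rewrite !linearZ /= -scalerAr eval_phi_basis.
Qed.

End Points.

(** * Changing the points by GL_2 *)

Section Action.

Variables (F : fieldType) (n : nat).
Local Notation R := {mpoly F[n]}.
Local Notation point := (2.-tuple R).
Implicit Types P Q : point.

(** The transpose of [g] applied to [P]: this is the action on points dual to
the substitution of variables, see [sym_eval_act]. *)
Definition move_point (g : 'M[F]_2) P : point :=
  [tuple \sum_i g i j *: tnth P i | j < 2].

Lemma sym_eval_act c g P (p : symR F c) :
  sym_eval P (rep_act (symR F c) g p) = sym_eval (move_point g P) p.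
Proof.
rewrite /sym_eval /= sym_actE.
rewrite (comp_mpolyEX _ (gl2_subst g)) (comp_mpolyEX _ (move_point g P)).
rewrite raddf_sum /=; apply: eq_bigr => m _.
rewrite comp_mpolyZ !comp_mpolyX rmorph_prod /=.
congr (_ *: _); apply: eq_bigr => j _; rewrite rmorphXn /= !tnth_mktuple.
congr (_ ^+ _); rewrite raddf_sum /=; apply: eq_bigr => k _.
by rewrite comp_mpolyZ comp_mpolyXU -tnth_nth.
Qed.

Lemma wedge_eval_act r c g (P : {ffun 'I_r -> point}) (x : ext r (symR F c)) :
  wedge_eval P (rep_act (extR r (symR F c)) g x)
  = wedge_eval [ffun a => move_point g (P a)] x.
Proof. by apply: ext_eval_map => a v; rewrite ffunE; apply: sym_eval_act. Qed.

Lemma eval_source_act N d g (P : {ffun 'I_N -> point}) Q x :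
  eval_source P Q (rep_act (tensorR (symR F N.-1) (extR N.+1 (symR F d.+1))) g x)
  = eval_source [ffun a => move_point g (P a)] (move_point g Q) x.
Proof.
have snocE : snoc [ffun a => move_point g (P a)] (move_point g Q) =
    [ffun a => move_point g (snoc P Q a)].
  by apply/ffunP => a; rewrite !ffunE; case: unlift => [b|]; rewrite ?ffunE.
rewrite /eval_source snocE.
apply: tensor_eval_map => [v|w]; [exact: sym_eval_act | exact: wedge_eval_act].
Qed.

Lemma eval_target_act N d g (P : {ffun 'I_N -> point}) Q x :
  eval_target P Q (rep_act (tensorR (extR N (symR F d)) (symR F d)) g x)
  = eval_target [ffun a => move_point g (P a)] (move_point g Q) x.
Proof.
apply: tensor_eval_map => [v|w]; first exact: wedge_eval_act.
exact: sym_eval_act.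
Qed.

Lemma tnth_move g P j : tnth (move_point g P) j
  = g ord0 j *: fstc P + g ord_max j *: sndc P.
Proof.
rewrite tnth_mktuple big_ord_recl big_ord1.
by rewrite (_ : lift _ _ = ord_max) //; apply/val_inj.
Qed.

Lemma fstc_move g P : fstc (move_point g P)
  = g ord0 ord0 *: fstc P + g ord_max ord0 *: sndc P.
Proof. exact: tnth_move. Qed.

Lemma sndc_move g P : sndc (move_point g P)
  = g ord0 ord_max *: fstc P + g ord_max ord_max *: sndc P.
Proof. exact: tnth_move. Qed.

Lemma bracket_move g P Q :
  bracket (move_point g P) (move_point g Q) = \det g *: bracket P Q.
Proof.
rewrite det_2x2 /bracket !fstc_move !sndc_move.
rewrite -!mul_mpolyC mpolyCB !mpolyCM; ring.
Qed.

End Action.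

(** * Generic points *)

Section Generic.

Variables (F : fieldType).

Definition generic_point n (a : 'I_n) : 2.-tuple {mpoly F[n]} := [tuple 1; 'X_a].

Lemma fstc_generic n (a : 'I_n) : fstc (generic_point a) = 1.
Proof. by []. Qed.

Lemma sndc_generic n (a : 'I_n) : sndc (generic_point a) = 'X_a.
Proof. by []. Qed.

Lemma bracket_generic n (a b : 'I_n) :
  bracket (generic_point a) (generic_point b) = 'X_b - 'X_a.
Proof. by rewrite /bracket !fstc_generic !sndc_generic mul1r mulr1. Qed.

Lemma mpolyX_neq n (a b : 'I_n) : a != b -> 'X_a - 'X_b != 0 :> {mpoly F[n]}.
Proof.
move=> ab; apply/eqP => /(congr1 (mcoeff U_(a))).
rewrite mcoeffB !mcoeffX mcoeff0 eqxx eq_mnm1 eq_sym (negPf ab).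
by move/eqP; rewrite subr0 oner_eq0.
Qed.

(** It is a polynomial of degree at most 1 whose two coefficients form a column of
[g]; this makes [eval_phi] applicable to the moved points. *)
Lemma fstc_move_generic n g (a : 'I_n) : g \in unitmx ->
  fstc (move_point g (generic_point a)) != 0.
Proof.
move=> gu.
have -> : fstc (move_point g (generic_point a)) = (g ord0 ord0)%:MP + g ord_max ord0 *: 'X_a.
  by rewrite fstc_move fstc_generic sndc_generic -[_ *: 1]mul_mpolyC mulr1.
apply/eqP => E.
have := congr1 (mcoeff U_(a)) E.
rewrite mcoeffD mcoeffC mcoeffZ mcoeffX eqxx mcoeff0 mnm1_eq0 mulr0 add0r mulr1.
have := congr1 (mcoeff 0%MM) E.
rewrite mcoeffD mcoeffC mcoeffZ mcoeffX eqxx mcoeff0 mnm1_eq0 mulr0 addr0 mulr1.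
move=> g0 g1; move: gu; rewrite unitmxE det_2x2 g0 g1 mul0r mulr0 subrr.
by rewrite unitr0.
Qed.

(** In the Leibniz expansion of the alternant of [S] the exponents of the monomials
are the rearrangements of [S], and [S] itself is the only increasing one.  The
factor ['X_[q]] lives in the variables outside the image of [h], and leaves
room for the symmetric factor of a tensor. *)
Lemma alternant_coeff n r m (h : 'I_r -> 'I_n) (S T : incr r m) (q q' : 'X_{1..n}) :
  injective h -> (forall a, q (h a) = 0%N) -> (forall a, q' (h a) = 0%N) ->
  (\det (\matrix_(a, b) 'X_(h a) ^+ S b) * 'X_[q] : {mpoly F[n]})
    @_(\sum_a U_(h a) *+ T a + q')%MM = ((S == T) && (q == q'))%:R.
Proof.
move=> h_inj q0 q'0.
pose mon (f : 'I_r -> nat) q := (\sum_a U_(h a) *+ f a + q)%MM.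
have monE f (p : 'X_{1..n}) a : p (h a) = 0%N -> mon f p (h a) = f a.
  move=> pa; rewrite mnmDE mnm_sumE pa addn0 (bigD1 a) //= mulmnE mnm1E eqxx mul1n.
  rewrite big1 ?addn0 // => b ba; rewrite mulmnE mnm1E (inj_eq h_inj).
  by rewrite (negPf ba).
have detE : \det (\matrix_(a, b) 'X_(h a) ^+ S b) * 'X_[q] =
    \sum_(s : 'S_r) (-1) ^+ s *: 'X_[mon (fun a => S (s a)) q] :> {mpoly F[n]}.
  rewrite mulr_suml; apply: eq_bigr => s _; rewrite /mon mpolyXD.
  rewrite (big_morph _ (@mpolyXD n F) (mpolyX0 n F)) scalerAl; congr (_ * _).
  rewrite scaler_sign -mulr_sign; congr (_ * _).
  by apply: eq_bigr => a _; rewrite mxE mpolyXn.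
rewrite detE raddf_sum /= -/(mon (fun a => T a) q').
have -> : \sum_(s : 'S_r) ((-1) ^+ s *: 'X_[mon (fun a => S (s a)) q])@_(mon (fun a => T a) q')
   = \sum_(s : 'S_r) (-1) ^+ s * (mon (fun a => S (s a)) q == mon (fun a => T a) q')%:R :> F.
  by apply: eq_bigr => s _; rewrite mcoeffZ mcoeffX.
have sE (s : 'S_r) : mon (fun a => S (s a)) q = mon (fun a => T a) q' ->
    S = T /\ s = 1%g.
  move=> E; have ST a : S (s a) = T a.
    apply/val_inj; have := monE (fun a => S (s a)) q a (q0 a).
    by rewrite E monE //= => ->.
  have eST : S = T.
    by apply: incr_im_inj => a; exists (s^-1 a)%g; rewrite -ST permKV.
  split=> //; apply/permP => a; rewrite perm1; apply: (@incr_inj _ _ S).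
  by rewrite ST eST.
rewrite (bigD1 1%g) //= odd_perm1 mul1r big1 ?addr0 => [|s s1]; last first.
  by case: eqP => [/sE[_ /eqP]|]; rewrite ?(negPf s1) ?mulr0.
congr (_ %:R); apply/congr1; apply/eqP/andP => [E|[/eqP -> /eqP ->]].
  have [eST _] := sE _ E; rewrite eST eqxx; split=> //; apply/eqP/mnmP => i.
  move: E; rewrite /mon eST; under eq_bigr do rewrite perm1.
  by move=> /mnmP/(_ i); rewrite !mnmDE => /addnI.
by rewrite /mon; congr (_ + _)%MM; apply: eq_bigr => a _; rewrite perm1.
Qed.

End Generic.

Section Genericity.

Variable F : fieldType.

Definition generic_points n : {ffun 'I_n -> 2.-tuple {mpoly F[n]}} :=
  [ffun a => generic_point F a].

Definition other_points N (b : 'I_N.+1) : {ffun 'I_N -> 2.-tuple {mpoly F[N.+1]}} :=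
  [ffun a => generic_point F (lift b a)].

Lemma wedge_eval_generic_inj r c (x : ext r (symR F c)) :
  wedge_eval (generic_points r) x = 0 -> x = 0.
Proof.
have FB : is_basis (fun S : incr r c.+1 => Fwedge F S) by
  exact: ext_basis (mono_basis F c).
have [e ->] := basis_spanning FB x => E.
have coeffE (S T : incr r c.+1) :
    (wedge_eval (generic_points r) (Fwedge F S))@_(\sum_a U_(a) *+ T a + 0)%MM
    = (S == T)%:R.
  rewrite wedge_eval_Fwedge -[\det _]mulr1 -mpolyX0.
  have -> : \matrix_(a, b) (fstc (generic_points r a) ^+ (c - S b)
        * sndc (generic_points r a) ^+ S b) = \matrix_(a, b) 'X_a ^+ S b.
    apply/matrixP => a b; rewrite !mxE ffunE.
    by rewrite fstc_generic sndc_generic expr1n mul1r.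
  have zero0 (a : 'I_r) : (0%MM : 'X_{1..r}) a = 0%N by rewrite mnm0E.
  by rewrite (alternant_coeff F S T (@inj_id _) zero0 zero0) eqxx andbT.
rewrite linear_sum /= in E.
apply: big1 => T _; suff -> : e T = 0 by rewrite scale0r.
have := congr1 (mcoeff (\sum_a U_(a) *+ T a + 0)%MM) E.
rewrite mcoeff0 raddf_sum (bigD1 T) //= [X in _ + X = _]big1 => [|S ST].
  by rewrite linearZ /= mcoeffZ coeffE eqxx mulr1 addr0.
by rewrite linearZ /= mcoeffZ coeffE (negPf ST) mulr0.
Qed.

Lemma eval_target_generic_inj N d (x : tensorR (extR N (symR F d)) (symR F d)) :
  eval_target (other_points ord_max) (generic_point F ord_max) x = 0 -> x = 0.
Proof.
have FB : is_basis (fun p : incr N d.+1 * 'I_d.+1 => Ften F p.1 p.2) by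
  exact: (tensor_basis (ext_basis N (mono_basis F d)) (mono_basis F d)).
have [e ->] := basis_spanning FB x => E.
have coeffE (S T : incr N d.+1) (j j' : 'I_d.+1) :
    (eval_target (other_points ord_max) (generic_point F ord_max) (Ften F S j))
      @_(\sum_a U_(lift ord_max a) *+ T a + U_(ord_max) *+ j')%MM
    = ((S, j) == (T, j'))%:R.
  rewrite eval_target_Ften fstc_generic sndc_generic expr1n mul1r mpolyXn.
  have -> : ((S, j) == (T, j')) =
      (S == T) && (U_(ord_max) *+ j == U_(ord_max) *+ j' :> 'X_{1..N.+1})%MM.
    rewrite xpair_eqE; congr (_ && _); apply/eqP/eqP => [-> //|/mnmP/(_ ord_max)].
    by rewrite !mulmnE mnm1E eqxx !mul1n => /val_inj.
  have U0 k a : (U_(ord_max) *+ k : 'X_{1..N.+1})%MM (lift ord_max a) = 0%N.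
    by rewrite mulmnE mnm1E (negPf (neq_lift _ _)).
  have -> : \matrix_(a, b) (fstc (other_points ord_max a) ^+ (d - S b)
        * sndc (other_points ord_max a) ^+ S b)
      = \matrix_(a, b) 'X_(lift ord_max a) ^+ S b :> 'M[{mpoly F[N.+1]}]_N.
    apply/matrixP => a b; rewrite !mxE ffunE.
    by rewrite fstc_generic sndc_generic expr1n mul1r.
  exact: (alternant_coeff F S T (@lift_inj _ ord_max) (U0 j) (U0 j')).
rewrite linear_sum /= in E.
apply: big1 => -[T j'] _; suff -> : e (T, j') = 0 by rewrite scale0r.
have := congr1 (mcoeff (\sum_a U_(lift ord_max a) *+ T a + U_(ord_max) *+ j')%MM) E.
rewrite mcoeff0 raddf_sum (bigD1 (T, j')) //= [X in _ + X = _]big1 => [|[S j] ST].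
  by rewrite linearZ /= mcoeffZ coeffE eqxx mulr1 addr0.
by rewrite linearZ /= mcoeffZ coeffE (negPf ST) mulr0.
Qed.

Lemma tensor_decomp N d (x : tensorR (symR F N.-1) (extR N.+1 (symR F d.+1))) :
  exists w : 'I_N.-1.+1 -> extR N.+1 (symR F d.+1),
    x = \sum_s tens (mono F s) (w s).
Proof.
have [e ->] := basis_spanning (source_basis F N d) x.
exists (fun s => \sum_(k : incr N.+1 d.+2) e (s, k) *: Fwedge F k).
have tB := tensor_bilinear (symR F N.-1) (extR N.+1 (symR F d.+1)).
rewrite [RHS](eq_bigr (fun s => \sum_k e (s, k) *: tens (mono F s) (Fwedge F k))).
  by rewrite pair_bigA /=; apply: eq_bigr => -[].
by move=> s _; rewrite bilinear_sumr.
Qed.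

End Genericity.

(** * Kernel, image and equivariance of phi *)

Section Isomorphism.

Variables (F : fieldType) (N d : nat).
Hypothesis N0 : (0 < N)%N.

Local Notation R := {mpoly F[N.+1]}.
Local Notation Src := (tensorR (symR F N.-1) (extR N.+1 (symR F d.+1))).
Local Notation Tgt := (tensorR (extR N (symR F d)) (symR F d)).

Definition coeff_poly (w : 'I_N.-1.+1 -> extR N.+1 (symR F d.+1)) : {poly R} :=
  \poly_(s < N.-1.+1) wedge_eval (generic_points F N.+1) (w (inord s)).

(** The key identity with the generic point numbered [b] as Q.  The sign is that of
the cycle moving the row of this point to its place among the others, so that
the right hand sides for all b are the values of one polynomial. *)
Lemma eval_phi_horner (w : 'I_N.-1.+1 -> extR N.+1 (symR F d.+1)) (b : 'I_N.+1) :
  (\prod_(a < N) ('X_b - 'X_(lift b a))) * ((-1) ^+ (b + N) *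
    eval_target (other_points F b) (generic_point F b)
      (phi F N d (\sum_s tens (mono F s) (w s))))
  = (coeff_poly w).['X_b].
Proof.
have brE : \prod_(a < N) ('X_b - 'X_(lift b a) : R) =
    \prod_(a < N) bracket (other_points F b a) (generic_point F b).
  by apply: eq_bigr => a _; rewrite ffunE bracket_generic.
rewrite brE mulrCA eval_phi // ?fstc_generic ?oner_neq0 //.
rewrite horner_poly linear_sum mulr_sumr; apply: eq_bigr => s _ /=.
rewrite inord_val /eval_source tensor_eval_tens /= sym_eval_mono.
rewrite fstc_generic sndc_generic expr1n mul1r mulrCA mulrC; congr (_ * _).
have [e ->] := basis_spanning (ext_basis N.+1 (mono_basis F d.+1)) (w s).
rewrite !linear_sum mulr_sumr; apply: eq_bigr => k _.
rewrite !linearZ /= -scalerAr; congr (_ *: _).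
rewrite -[wedge _]/(Fwedge F k) !wedge_eval_Fwedge.
set A := (X in _ = \det X).
rewrite (@det_move_row _ N A _ b) => [|c|a c].
- by rewrite mulrA -exprD -signr_odd addnn odd_double mul1r.
- by rewrite !mxE !ffunE unlift_none.
- by rewrite !mxE !ffunE liftK ffunE.
Qed.

Lemma mpolyX_inj : injective (fun a : 'I_N.+1 => 'X_a : R).
Proof.
move=> a b /= e; apply/eqP/negPn/negP => /(mpolyX_neq F).
by rewrite e subrr eqxx.
Qed.

Lemma wedge_eval_mu (P : {ffun 'I_N.+1 -> 2.-tuple R}) (y : Tgt) :
  wedge_eval P (mu N (symR F d) y) = \sum_(b < N.+1) (-1) ^+ (b + N) *
    eval_target [ffun a => P (lift b a)] (P b) y.
Proof.
apply: etrans (ext_eval_mu (fun a => @sym_eval F N.+1 d (P a)) y) _.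
apply: eq_bigr => b _.
apply: (congr1 (fun z => _ * z)).
apply: tensor_eval_eq => [x|//].
by apply: ext_eval_eq => a v; rewrite ffunE.
Qed.

(** Up to the nonzero Vandermonde determinant, the value of [mu (phi x)] at the
generic points is the coefficient of degree N of [coeff_poly w], whose degree is
less than N. *)
Lemma phi_in_Delta (x : Src) : phi F N d x \in Delta N (symR F d).
Proof.
have [w ->] := tensor_decomp x; set y := phi _ _ _ _.
rewrite memv_ker; apply/eqP/wedge_eval_generic_inj.
apply: (mulfI (det_Vandermonde_neq0 mpolyX_inj)); rewrite mulr0.
rewrite wedge_eval_mu mulr_sumr.
transitivity (\sum_b (coeff_poly w).['X_b] *
    cofactor (\matrix_(b, s) 'X_b ^+ s : 'M[R]_N.+1) b ord_max).
  apply: eq_bigr => b _.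
  rewrite -eval_phi_horner -/y -(cofactor_prod (fun a => 'X_a) b).
  have -> : [ffun a => generic_points F N.+1 (lift b a)] = other_points F b.
    by apply/ffunP => a; rewrite !ffunE.
  by rewrite [generic_points F _ b]ffunE mulrAC.
have sz : (size (coeff_poly w) <= N)%N by rewrite -[X in (_ <= X)%N](prednK N0) size_poly.
rewrite sum_horner_cofactor; last exact: leqW.
by rewrite nth_default ?mul0r.
Qed.

(** [coeff_poly w] has degree less than N and the N + 1 generic coordinates as
roots. *)
Lemma phi_inj (x : Src) : phi F N d x = 0 -> x = 0.
Proof.
have [w ->] := tensor_decomp x => E.
have q0 : coeff_poly w = 0.
  apply: (@roots_geq_poly_eq0 _ _ [seq 'X_a : R | a <- enum 'I_N.+1]).
  - apply/allP => _ /mapP[b _ ->]; rewrite /root -eval_phi_horner E.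
    by rewrite linear0 !mulr0.
  - by rewrite map_inj_uniq ?enum_uniq //; apply: mpolyX_inj.
  - rewrite size_map size_enum_ord; apply: leqW.
    by rewrite -[X in (_ <= X)%N](prednK N0) size_poly.
apply: big1 => s _; have -> : w s = 0.
  apply: wedge_eval_generic_inj; have := congr1 (fun p : {poly R} => p`_s) q0.
  by rewrite coef_poly ltn_ord inord_val coef0.
have [_ tr] := tensor_bilinear (symR F N.-1) (extR N.+1 (symR F d.+1)).
by have := tr (mono F s) (-1) 0 0; rewrite scaler0 addr0 scaleN1r addNr.
Qed.

(** The product of brackets is cancelled at the generic points, where it does not
vanish, after both sides are evaluated by [eval_phi]: once at the generic
points and once at their images under [g]. *)
Lemma phi_act g (x : Src) : g \in unitmx ->
  phi F N d (rep_act Src g x) = \det g ^+ N *: rep_act Tgt g (phi F N d x).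
Proof.
move=> gu; apply/eqP; rewrite -subr_eq0; apply/eqP/eval_target_generic_inj.
rewrite linearB linearZ /=.
set P := other_points F ord_max; set Q := generic_point F ord_max.
have br0 : \prod_a bracket (P a) Q != 0.
  apply/prodf_neq0 => a _; rewrite ffunE bracket_generic mpolyX_neq //.
  exact: neq_lift.
apply: (mulfI br0); rewrite mulr0 mulrBr.
rewrite eval_phi ?fstc_generic ?oner_neq0 //.
rewrite eval_source_act -eval_phi ?fstc_move_generic //.
rewrite -scalerAr [eval_target P Q _]eval_target_act.
have -> : \prod_a bracket ([ffun a => move_point g (P a)] a) (move_point g Q)
    = \det g ^+ N *: \prod_a bracket (P a) Q.
  under eq_bigr do rewrite ffunE bracket_move.
  by rewrite scaler_prod prodr_const card_ord.
by rewrite scalerAl subrr.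
Qed.

End Isomorphism.

(** * Dimensions *)

Lemma card_incr r n : #|{: incr r n}| = 'C(n, r).
Proof.
rewrite -card_ltn_sorted_tuples.
pose f (S : incr r n) : r.-tuple 'I_n := [tuple S a | a < r].
have f_inj : injective f.
  move=> S T e; apply/val_inj/ffunP => a /=.
  by have := congr1 (fun t => tnth t a) e; rewrite !tnth_mktuple.
rewrite -(card_imset _ f_inj); apply: eq_card => t.
have nthE (a : 'I_r) : nth 0%N [seq val i | i <- t] a = tnth t a.
  by rewrite (nth_map (tnth t a)) ?size_tuple // -tnth_nth.
rewrite inE; apply/imsetP/idP => [[S _ tS]|st].
  apply/(sortedP 0%N) => i; rewrite size_map size_tuple => ir.
  have := nthE (Ordinal ir); have := nthE (Ordinal (ltnW ir)) => /= -> ->.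
  by rewrite tS !tnth_mktuple; apply: incr_lt => /=.
have Sinc : increasing [ffun a => tnth t a].
  apply/forallP => a; apply/forallP => b; apply/implyP => ab; rewrite !ffunE.
  have := sorted_ltn_nth ltn_trans 0%N st; rewrite -!nthE => h.
  by apply: h => //; rewrite inE size_map size_tuple.
exists (Incr Sinc) => //; apply: eq_from_tnth => a.
by rewrite tnth_mktuple ffunE.
Qed.

Lemma mu_surj (F : fieldType) N (V : vectType F) : limg (mu N V) = fullv.
Proof.
apply/eqP; rewrite eqEsubv subvf /=; apply/subvP => x _.
rewrite [x]ext_span; apply: rpred_sum => S _; apply: rpredZ.
set v := finfun _.
have -> : wedge v = mu N V (tens (wedge [ffun a => v (lift ord_max a)]) (v ord_max)).
  rewrite muE; congr wedge; apply/ffunP => a; rewrite !ffunE.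
  by case: unliftP => [b ->|->]; rewrite ?ffunE.
exact: memv_img (memvf _).
Qed.

Lemma dim_ext (F : fieldType) r n (V : vectType F) : dim V = n ->
  dim (ext r V) = 'C(n, r).
Proof. by move=> <-; rewrite -card_incr -[LHS]/(#|{: incr r (dim V)}| * 1)%N muln1. Qed.

Lemma dim_Delta (F : fieldType) N (V : vectType F) n : dim V = n ->
  (\dim (Delta N V) + 'C(n, N.+1) = 'C(n, N) * n)%N.
Proof.
move=> nV; have := limg_ker_dim (mu N V) fullv.
rewrite mu_surj capfv !dimvf (dim_ext N.+1 nV) => ->.
by rewrite -[LHS]/(dim (ext N V) * dim V)%N (dim_ext N nV) nV.
Qed.

Lemma dim_symR (F : fieldType) c : dim (symR F c) = c.+1.
Proof. by rewrite -(is_basis_card (mono_basis F c)) card_ord. Qed.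

(** Pascal's rule and (N + 1) C(n, N + 1) = (n - N) C(n, N). *)
Lemma mul_bin_hook N n :
  (N * 'C(n.+1, N.+1) + 'C(n, N.+1) = 'C(n, N) * n)%N.
Proof.
rewrite binS mulnDr addnAC -mulSnr mul_bin_left.
case: (leqP N n) => Nn; last by rewrite bin_small // !muln0.
by rewrite -mulnDl subnK // mulnC.
Qed.

Lemma dim_source_Delta (F : fieldType) N d : (0 < N)%N ->
  dim (tensorR (symR F N.-1) (extR N.+1 (symR F d.+1)))
  = \dim (Delta N (symR F d)).
Proof.
move=> N0; apply/eqP; rewrite -(eqn_add2r 'C(d.+1, N.+1)).
rewrite (dim_Delta N (dim_symR F d)) -mul_bin_hook.
rewrite -[dim _]/(dim (symR F N.-1) * dim (ext N.+1 (symR F d.+1)))%N.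
by rewrite dim_symR (dim_ext N.+1 (dim_symR F d.+1)) prednK.
Qed.

Theorem corollary3p1 (F : fieldType) (N d : nat) (hN : (0 < N)%N) :
  exists f : 'Hom(tensorR (symR F N.-1) (extR N.+1 (symR F d.+1)),
                  detR N (DeltaR N (symR F d))),
    rep_isom f /\ (forall x, vsval (f x) = phi F N d x).
Proof.
pose D := Delta N (symR F d).
pose h x : detR N (DeltaR N (symR F d)) := vsproj D (phi F N d x).
have hl : linear h by move=> c x y; rewrite /h !linearP.
pose hlin := HB.pack_for
  {linear tensorR (symR F N.-1) (extR N.+1 (symR F d.+1)) ->
          detR N (DeltaR N (symR F d))} h
  (GRing.isLinear.Build _ _ _ _ _ hl).
pose f := linfun hlin.
have fE x : vsval (f x) = phi F N d x.
  by rewrite lfunE /= vsprojK // phi_in_Delta.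
have ker0 : lker f == 0%VS.
  rewrite -subv0; apply/subvP => x; rewrite memv_ker memv0 => /eqP fx0.
  by apply/eqP/(phi_inj hN); rewrite -fE fx0.
have img : limg f = fullv.
  apply/eqP; rewrite eqEdim subvf /= limg_dim_eq ?(eqP ker0) ?capv0 // !dimvf.
  by rewrite (dim_source_Delta F d hN).
exists f; split; last exact: fE.
split=> [|g gu x].
  exists (f^-1)%VF; first exact: lker0_lfunK.
  by move=> y; rewrite limg_lfunVK // img memvf.
have actE : vsval (rep_act (DeltaR N (symR F d)) g (f x)) =
    rep_act (tensorR (extR N (symR F d)) (symR F d)) g (phi F N d x).
  apply: etrans (subR_actE (@Delta_stable F N (symR F d)) (f x) gu) _.
  by rewrite fE.
apply/val_inj; apply: etrans (fE _) _; rewrite phi_act // -actE.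
by rewrite [in RHS]/= scale_lfunE linearZ.
Qed.
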